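(* Let $J=[q_L,q_R]$ be a relative plateau generated by the admissible word $\mathbf a=a_1\ldots a_m$. Then the entropy function $H_J:q\mapsto h(\widetilde{\mathbf U}_q(J))$ is a Devil's staircase on $(q_L,q_R]$, i.e., $H_J$ is continuous, non-decreasing and locally constant almost everywhere on $(q_L,q_R]$. Furthermore, the set $\widetilde{\mathbf U}_q(J)$ has the following structure: (i) If $q_L<q\le q_G(J)$, then $\widetilde{\mathbf U}_q(J)=\emptyset$. (ii) If $q_G(J)<q\le q_F(J)$, then $\widetilde{\mathbf U}_q(J)=\{(\mathbf a^+\overline{\mathbf a^+})^\infty\}$. (iii) If $q_F(J)<q<q_c(J)$, then $\widetilde{\mathbf U}_q(J)$ is countably infinite. (iv) If $q=q_c(J)$, then $\widetilde{\mathbf U}_q(J)$ is uncountable but $H_J(q)=0$. (v) If $q_c(J)<q\le q_R$, then $H_J(q)>0$.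
   Context: Fix an integer $M\ge1$ and let $\Omega_M=\{0,1,\ldots,M\}^{\mathbb N}$, with left shift $\sigma$. Sequences, and words of equal length, are compared lexicographically ($\prec,\preccurlyeq$). For a word or sequence $c$ over $\{0,\ldots,M\}$, $\overline c$ denotes its reflection, obtained by replacing each digit $c_i$ by $M-c_i$. For a word $c=c_1\ldots c_n$ with $c_n<M$ put $c^+:=c_1\ldots c_{n-1}(c_n+1)$. $c^\infty$ is the periodic sequence $ccc\cdots$. $\overline c^{\,+}$ means $(\overline c)^+$, while $\overline{c^+}$ is the reflection of $c^+$. For $q\in(1,M+1]$, a $q$-expansion of $x$ is a sequence $(d_i)\in\Omega_M$ with $x=\sum_{i\ge1}d_iq^{-i}$. $q_{KL}$ (the Komornik–Loreti constant) is the smallest $q\in(1,M+1]$ for which $1$ has a unique $q$-expansion. $\alpha(q)$ is the lexicographically largest $q$-expansion of $1$ not ending with $0^\infty$. The map $q\mapsto\alpha(q)$ is strictly increasing and bijective from $(1,M+1]$ onto the set of sequences $(a_i)\in\Omega_M$ not ending with $0^\infty$ with $\sigma^n((a_i))\preccurlyeq(a_i)$ for all $n\ge0$. $\widetilde{\mathbf U}_q:=\{(d_i)\in\Omega_M:\overline{\alpha(q)}\prec\sigma^n((d_i))\prec\alpha(q)\ \forall n\ge0\}$. For $X\subset\Omega_M$, $h(X):=\liminf_{n\to\infty}\frac1n\log\#B_n(X)$, where $B_n(X)$ is the set of length-$n$ words occurring in sequences of $X$; $h(\emptyset):=0$. Relative plateaus: a word $\mathbf a=a_1\ldots a_m$ with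 $m\ge2$ is admissible if $\overline{a_1\ldots a_{m-i}}\preccurlyeq a_{i+1}\ldots a_m\prec a_1\ldots a_{m-i}$ for all $1\le i<m$; when $M\ge2$, a single digit $a_1$ is admissible if $\overline{a_1}\le a_1<M$. An admissible word $\mathbf a$ generates the basic interval $[q_L,q_R]$ given by $\alpha(q_L)=\mathbf a^\infty$, $\alpha(q_R)=\mathbf a^+(\overline{\mathbf a})^\infty$. For the basic interval $I$ generated by $\mathbf a=a_1\ldots a_m$, the number $q_c(I)$ is defined by $\alpha(q_c(I))=(\theta_i)$, where $\theta_1\ldots\theta_m=\mathbf a^+$ and $\theta_{2^{k-1}m+1}\ldots\theta_{2^km}=\overline{\theta_1\ldots\theta_{2^{k-1}m}}^{\,+}$ for $k=1,2,\ldots$. An entropy plateau is a maximal interval $[p_L,p_R]\subset(1,M+1]$ on which $q\mapsto h(\widetilde{\mathbf U}_q)$ is constant and positive (these are known to be exactly the maximal basic intervals lying completely to the right of $q_{KL}$). The relative plateaus are the intervals $J_{\mathbf i}$, $\mathbf i\in\bigcup_{n\ge0}\{1,2,\ldots\}^n$, defined recursively: $J_\emptyset=[1,M+1]$; $J_1,J_2,\ldots$ is an enumeration of the entropy plateaus; and for $\mathbf i\in\{1,2,\ldots\}^n$, $n\ge1$, with $J_{\mathbf i}=[q_L,q_R]$, the intervals $J_{\mathbf i1},J_{\mathbf i2},\ldots$ enumerate the maximal basic intervals contained in $[q_c(J_{\mathbf i}),q_R]$. Every relative plateau other than $J_\emptyset$ is generated by an admissible word; only such $J$ are considered here. For a relative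 plateau $J=[q_L,q_R]$ generated by $\mathbf a=a_1\ldots a_m$ and $q\in(q_L,q_R]$, $\widetilde{\mathbf U}_q(J):=\{(x_i)\in\widetilde{\mathbf U}_q:x_1\ldots x_m=\mathbf a^+\}$. The bases $q_G(J),q_F(J)\in(q_L,q_R)$ are defined by $\alpha(q_G(J))=(\mathbf a^+\overline{\mathbf a^+})^\infty$ and $\alpha(q_F(J))=(\mathbf a^+\,\overline{\mathbf a}\,\overline{\mathbf a^+}\,\mathbf a)^\infty$; one has $q_G(J)<q_F(J)<q_c(J)$. *)

(* Defs.v *)
From HB Require Import structures.
From mathcomp Require Import all_boot all_order all_algebra.
From mathcomp Require Import all_classical all_reals all_analysis.

Set Implicit Arguments.
Unset Strict Implicit.
Unset Printing Implicit Defensive.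
Import Order.TTheory GRing.Theory Num.Theory.
Import numFieldNormedType.Exports.
Local Open Scope classical_set_scope.
Local Open Scope ring_scope.

(* Sequences are indexed from 0: the digit written x_(i+1) in the usual
   1-based notation is [x i]. [Omega M] carries the lexicographic order of
   [big_lexi_order], and [word M] that of [seqlexi], which on words of equal
   length is the usual lexicographic comparison. *)
Notation Omega M := (big_lexi_order (fun _ : nat => 'I_M.+1)).
Notation word M := (seqlexi 'I_M.+1).

Definition seq_shift (M n : nat) (x : Omega M) : Omega M := fun i => x (n + i)%N.

(* [rev_ord d] has value [M - d]. *)
Definition refl_seq (M : nat) (x : Omega M) : Omega M := fun i => rev_ord (x i).
Definition refl_word (M : nat) (c : word M) : word M :=
  map (@rev_ord M.+1) c.

(* c^+; only meaningful for nonempty c whose last digit is < M. *)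
Definition wplus (M : nat) (c : word M) : word M :=
  rcons (take (size c).-1 c) (inord (last ord0 c).+1).

(* c^oo, for nonempty c *)
Definition wcycle (M : nat) (c : word M) : Omega M :=
  fun i => nth ord0 c (i %% size c).

Definition prepend (M : nat) (c : word M) (x : Omega M) : Omega M :=
  fun i => if (i < size c)%N then nth ord0 c i else x (i - size c)%N.

Definition ends_with_zeros (M : nat) (x : Omega M) : Prop :=
  exists N, forall n, (N <= n)%N -> x n = ord0.

Definition is_expansion (R : realType) (M : nat) (q x : R) (d : Omega M) : Prop :=
  series (fun i => (d i : nat)%:R / q ^+ i.+1) @ \oo --> x.

Definition is_quasi_greedy (R : realType) (M : nat) (q : R) (s : Omega M) : Prop :=
  [/\ is_expansion q 1 s, ~ ends_with_zeros s &
      forall t : Omega M, is_expansion q 1 t -> ~ ends_with_zeros t ->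
        (t <= s)%O].

(* Such a sequence exists, and is unique, for 1 < q <= M + 1; outside this
   range the value is irrelevant. *)
Definition alpha (R : realType) (M : nat) (q : R) : Omega M :=
  xget (fun=> ord0) [set s : Omega M | is_quasi_greedy q s].

(* "q is the base in (1, M + 1] given by alpha(q) = s" *)
Definition has_alpha (R : realType) (M : nat) (q : R) (s : Omega M) : Prop :=
  1 < q <= M.+1%:R /\ alpha M q = s.

Definition Utilde (R : realType) (M : nat) (q : R) : set (Omega M) :=
  [set d : Omega M | forall n,
     (refl_seq (alpha M q) < seq_shift n d)%O /\ (seq_shift n d < alpha M q)%O].

Definition language (M : nat) (X : set (Omega M)) (n : nat) :
    {set n.-tuple 'I_M.+1} :=
  [set w : n.-tuple 'I_M.+1 |
    `[< exists x : Omega M, X x /\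
        exists k, forall i : 'I_n, x (k + i)%N = tnth w i >]]%SET.

Definition entropy (R : realType) (M : nat) (X : set (Omega M)) : R :=
  if `[< X = set0 >] then 0
  else limn_inf (fun n => n%:R^-1 * ln (#|language X n|%:R : R)).

Definition admissible (M : nat) (a : word M) : Prop :=
  ((2 <= size a)%N /\
   forall i, (1 <= i < size a)%N ->
     (refl_word (take (size a - i) a) <= (drop i a : word M))%O /\
     ((drop i a : word M) < (take (size a - i) a : word M))%O)
  \/
  ((2 <= M)%N /\
   exists2 d : 'I_M.+1, a = [:: d] & (rev_ord d <= d < M)%N).

(* The interval [qL, qR] is the basic interval generated by a. *)
Definition generates (R : realType) (M : nat) (a : word M) (qL qR : R) : Prop :=
  [/\ admissible a,
      has_alpha qL (wcycle a) &
      has_alpha qR (prepend (wplus a) (wcycle (refl_word a)))].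

Definition basic_interval (R : realType) (M : nat) (pL pR : R) : Prop :=
  exists a : word M, generates a pL pR.

(* [theta_prefix a k] = theta_1 ... theta_(2^k m), where m = [size a]. *)
Fixpoint theta_prefix (M : nat) (a : word M) (k : nat) : word M :=
  if k is k'.+1 then
    theta_prefix a k' ++ wplus (refl_word (theta_prefix a k'))
  else wplus a.

(* Each prefix extends the previous one and 2^i m > i, so position i is
   already determined by the i-th prefix. *)
Definition theta (M : nat) (a : word M) : Omega M :=
  fun i => nth ord0 (theta_prefix a i) i.

Definition constant_positive_entropy (R : realType) (M : nat) (pL pR : R) : Prop :=
  exists c : R, 0 < c /\
    forall q : R, pL <= q <= pR -> entropy R (Utilde (M := M) q) = c.

(* Maximality among closed intervals is the same as among all intervals: a
   larger interval with the property contains a larger closed one. The strict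
   inequality pL < pR excludes the degenerate intervals {q} at the points
   where the entropy is not constant on either side. *)
Definition entropy_plateau (R : realType) (M : nat) (pL pR : R) : Prop :=
  [/\ 1 < pL, pL < pR, pR <= M.+1%:R,
      constant_positive_entropy M pL pR &
      forall pL' pR' : R, 1 < pL' -> pR' <= M.+1%:R ->
        pL' <= pL -> pR <= pR' -> constant_positive_entropy M pL' pR' ->
        pL' = pL /\ pR' = pR].

Definition maximal_basic_within (R : realType) (M : nat) (lo hi pL pR : R) : Prop :=
  [/\ basic_interval M pL pR, lo <= pL, pR <= hi &
      forall pL' pR' : R, basic_interval M pL' pR' ->
        lo <= pL' -> pR' <= hi -> pL' <= pL -> pR <= pR' ->
        pL' = pL /\ pR' = pR].

(* The tree of intervals J_i, without the (arbitrary) enumeration of the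
   children of each node. The root is excluded as a parent in the last
   constructor because it is not generated by a word; its children are the
   entropy plateaus. *)
Inductive relative_plateau (R : realType) (M : nat) : R -> R -> Prop :=
| relative_plateau_root : relative_plateau M 1 M.+1%:R
| relative_plateau_entropy pL pR :
    entropy_plateau M pL pR -> relative_plateau M pL pR
| relative_plateau_child (a : word M) qL qR qc pL pR :
    relative_plateau M qL qR -> generates a qL qR -> has_alpha qc (theta a) ->
    maximal_basic_within M qc qR pL pR ->
    relative_plateau M pL pR.

Definition Urel (R : realType) (M : nat) (a : word M) (q : R) : set (Omega M) :=
  [set x : Omega M | Utilde q x /\ mkseq x (size a) = wplus a].

Definition Hrel (R : realType) (M : nat) (a : word M) (q : R) : R :=
  entropy R (Urel a q).

Definition devils_staircase (R : realType) (A : set R) (f : R -> R) : Prop :=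
  [/\ {within A, continuous f},
      {in A &, {homo f : x y / x <= y}} &
      {ae lebesgue_measure, forall x : R, A x ->
         \forall y \near within A (nbhs x), f y = f x}].

(* Main.v *)
Require Import Defs.
From HB Require Import structures.
From mathcomp Require Import all_boot all_order all_algebra.
From mathcomp Require Import all_classical all_reals all_analysis.
From mathcomp Require Import zify ring lra.
Set Implicit Arguments.
Unset Strict Implicit.
Unset Printing Implicit Defensive.
Import Order.TTheory GRing.Theory Num.Theory.
Import numFieldNormedType.Exports.
Local Open Scope classical_set_scope.
Local Open Scope ring_scope.

(** Let [a] be an admissible word of length [m]. Everything rests on a coding of the
    sequences in question by binary sequences.

    Let [x] start with [a^+], and let all its shifts lie between the reflection of
    [alpha(q)] and [alpha(q)], where [alpha(q)] is at most [a^+ (reflect a)^oo]. After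
    each block of length [m] the bounds leave only two possibilities for the next
    one, which differ by a unit in the last digit; recording the choice as a bit,
    one obtains a code of [x] ([univoque_decomposition]). The substitution that
    recovers [x] from its code preserves the lexicographic order ([lt_subst]), and
    the shifts that start inside a block satisfy all inequalities because [a] is
    admissible ([unaligned_shift_lt]). So if [alpha(q)] is the image of a binary
    sequence [t], then [Urel a q] is the image of the binary sequences that start
    with [1] and are univoque for the threshold [t] ([univoque_subst_bits],
    [univoque_subst_inv]). The bases [qG], [qF], [qc] and [qR] have the thresholds
    [(10)^oo], [(1100)^oo], the Thue-Morse sequence and [1^oo], for every [a].

    The word [10] over the binary alphabet is itself admissible in this sense, and
    its substitution, called [double], acts on thresholds: it sends [(10)^oo] to
    [(1100)^oo] and fixes the Thue-Morse sequence. A univoque sequence for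
    [double t] either alternates or eventually is, up to reflection, the image of a
    univoque sequence for [t] ([univoque_double_cases]). Nothing is univoque for
    [(10)^oo]; the iterates of [double] on [(10)^oo] increase to the Thue-Morse
    sequence, and those on [1^oo] decrease to it. This gives (i), (ii), (iii) and
    (v). At the Thue-Morse sequence, nested substitutions with a free binary choice
    at each level give uncountably many univoque sequences ([univoque_nested]).

    For the entropy, let [1 < b < 2] and consider the odd map [x |-> b x - sgn x] of
    [-1, 1] to itself. If the orbit of [1] avoids [0], the itinerary of [1] is a
    threshold whose univoque sequences have about [b ^ n] words of length [n]: at
    least that many because distances are multiplied by [b] ([many_prefixes]), at
    most that many because the total length of the images of an interval is
    multiplied by [b] while short images are rarely cut ([branch_count_bound]).
    Since every coded threshold of this kind is attained by a base
    ([alpha_surjective]), [Hrel a] takes the values [ln b / m] for a dense set of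
    [b]. A monotone function with dense values is continuous, so [Hrel a] is. These
    thresholds have uncountably many univoque sequences, so they are not below the
    Thue-Morse sequence; letting [b] tend to [1], the entropy at [qc] is zero.

    Finally, by the same density, [Hrel a] is constant near each base that is not a
    limit of bases whose quasi-greedy expansion has a code. The latter form a
    null set: two of them whose codes agree on [K] bits differ by at most a constant
    times [q ^ - (K m)], there are [2 ^ K] classes, and [q ^ m > 2] for [q > qL]
    ([coded_bases_cover]). *)

(** * Lexicographic order on sequences *)

Section Lexicographic.
Context {d : Order.disp_t} {T : orderType d}.
Local Notation sq := (big_lexi_order (fun _ : nat => T)).
Implicit Types x y z u v s : sq.
Local Open Scope order_scope.

Definition shift (n : nat) x : sq := fun i => x (n + i)%N.

Definition agree (n : nat) x y := forall i, (i < n)%N -> x i = y i.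

Lemma seq_ltP x y :
  x < y <-> exists n, agree n x y /\ x n < y n.
Proof.
rewrite lt_def leEbig_lexi_order; split.
- case/andP => yx; case E: (first_diff x y) => [n|].
    move/first_diff_SomeP: E => [pxy nxy] le_xy; exists n; split=> [i ltin|].
      exact: pxy.
    by rewrite lt_neqAle nxy.
  by move/first_diff_NoneP: E => E; rewrite E eqxx in yx.
- move=> [n [axy lt_xy]].
  have -> : first_diff x y = Some n.
    by apply/first_diff_SomeP; split; rewrite ?lt_eqF.
  rewrite ltW // andbT; apply/eqP => E; by rewrite E ltxx in lt_xy.
Qed.

Lemma agree_sym n x y : agree n x y -> agree n y x.
Proof. by move=> h i lti; rewrite h. Qed.

Lemma agree_trans n y x z : agree n x y -> agree n y z -> agree n x z.
Proof. by move=> h h' i lti; rewrite h ?h'. Qed.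

Lemma agree_le n m x y : (n <= m)%N -> agree m x y -> agree n x y.
Proof. by move=> nm h i lti; apply: h; apply: leq_trans nm. Qed.

Lemma shiftD n m x : shift n (shift m x) = shift (m + n) x.
Proof. by apply: funext => i; rewrite /shift addnA. Qed.

Lemma shift0 x : shift 0 x = x.
Proof. exact: funext. Qed.

Lemma lt_agree n x y : agree n x y -> (shift n x < shift n y) = (x < y).
Proof.
move=> axy; apply/idP/idP => /seq_ltP [k [h1 h2]]; apply/seq_ltP.
- exists (n + k)%N; split=> // i lti.
  case: (ltnP i n) => [/axy //|leni].
  by have := h1 (i - n)%N; rewrite /shift subnKC //; apply; rewrite ltn_subLR.
- case: (ltnP k n) => [/axy E|leni]; first by rewrite E ltxx in h2.
  exists (k - n)%N; rewrite /shift subnKC //; split=> // i lti.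
  by apply: h1; rewrite -ltn_subRL.
Qed.

Lemma le_agree n x y : agree n x y -> (shift n x <= shift n y) = (x <= y).
Proof. by move=> axy; rewrite !leNgt lt_agree //; apply: agree_sym. Qed.

(** This is how lexicographic bounds determine digits: if the bounds differ at
    place [n] only by a unit, the digit of [y] there is one of two. *)
Lemma agree_squeeze n x y z :
  agree n x z -> x <= y -> y <= z ->
  agree n y x /\ x n <= y n <= z n.
Proof.
move=> axz le_xy le_yz.
have ayx : agree n y x.
  elim: n axz => [|n IH] axz; first by move=> i.
  have ayx : agree n y x by apply: IH; apply: agree_le axz.
  have ayz : agree n y z.
    by apply: agree_trans ayx _; apply: agree_le axz.
  move=> i; rewrite ltnS leq_eqVlt => /predU1P[->{i}|/ayx //].
  apply/eqP; rewrite eq_le; apply/andP; split.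
    rewrite leNgt; apply/negP => lt_n; move: le_yz; rewrite leNgt => /negP; apply.
    by apply/seq_ltP; exists n; rewrite -(axz n) //; split=> //; apply: agree_sym.
  rewrite leNgt; apply/negP => lt_n; move: le_xy; rewrite leNgt => /negP; apply.
  by apply/seq_ltP; exists n.
split=> //; apply/andP; split; rewrite leNgt; apply/negP => lt_n.
  by move: le_xy; rewrite leNgt => /negP; apply; apply/seq_ltP; exists n.
move: le_yz; rewrite leNgt => /negP; apply; apply/seq_ltP; exists n; split=> //.
by apply: agree_sym; apply: agree_trans ayx axz.
Qed.

Lemma lt_head x y : x 0%N < y 0%N -> x < y.
Proof. by move=> h; apply/seq_ltP; exists 0%N. Qed.

Lemma le_head x y : x <= y -> x 0%N <= y 0%N.
Proof.
move=> le_xy; rewrite leNgt; apply/negP => /lt_head.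
by rewrite ltNge le_xy.
Qed.

Lemma lt_behead x y : x 0%N = y 0%N -> (shift 1 x < shift 1 y) = (x < y).
Proof. by move=> h; apply: lt_agree => -[]. Qed.

Lemma le_behead x y : x 0%N = y 0%N -> (shift 1 x <= shift 1 y) = (x <= y).
Proof. by move=> h; apply: le_agree => -[]. Qed.

(** A strict lexicographic inequality is decided by finitely many digits, so it
    survives the replacement of one side by a good enough approximation. *)
Lemma lt_seq_near x y (z : nat -> sq) :
  (forall k, agree k (z k) y) -> x < y -> exists k, x < z k.
Proof.
move=> az /seq_ltP[n [axy lt_xy]]; exists n.+1; apply/seq_ltP; exists n.
rewrite (az n.+1) //; split=> // i lti; rewrite (az n.+1) ?axy //.
exact: ltnW.
Qed.

Lemma gt_seq_near x y (z : nat -> sq) :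
  (forall k, agree k (z k) y) -> y < x -> exists k, z k < x.
Proof.
move=> az /seq_ltP[n [axy lt_xy]]; exists n.+1; apply/seq_ltP; exists n.
rewrite (az n.+1) //; split=> // i lti; rewrite (az n.+1) ?axy //.
exact: ltnW.
Qed.

Section Reflection.
Variable rev : T -> T.
Hypothesis revK : involutive rev.
Hypothesis rev_lt : forall a b, (rev a < rev b) = (b < a).

Definition reflect_seq x : sq := fun i => rev (x i).

Lemma reflect_seqK : involutive reflect_seq.
Proof. by move=> x; apply: funext => i; rewrite /reflect_seq revK. Qed.

Lemma lt_reflect x y : (reflect_seq x < reflect_seq y) = (y < x).
Proof.
have h u v : v < u -> reflect_seq u < reflect_seq v.
  move=> /seq_ltP[n [auv lt_uv]]; apply/seq_ltP; exists n.
  by rewrite /reflect_seq rev_lt; split=> // i /auv ->.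
by apply/idP/idP => /h //; rewrite !reflect_seqK.
Qed.

Lemma le_reflect x y : (reflect_seq x <= reflect_seq y) = (y <= x).
Proof. by rewrite !leNgt lt_reflect. Qed.

(** For [s = alpha(q)] these are the sequences of [Utilde q]; the threshold [s] is
    kept free because the binary codes have thresholds that are not
    expansions. *)
Definition univoque s : set sq :=
  [set x | forall n, reflect_seq s < shift n x /\ shift n x < s].

Lemma univoqueP s x : univoque s x <->
  (forall n, shift n x < s) /\ (forall n, shift n (reflect_seq x) < s).
Proof.
have h n : (reflect_seq s < shift n x) = (shift n (reflect_seq x) < s).
  by rewrite -(lt_reflect s) reflect_seqK.
split=> [H|[H1 H2] n]; last by rewrite h.
by split=> n; have [] := H n; rewrite ?h.
Qed.

Lemma univoque_reflect s x : univoque s x -> univoque s (reflect_seq x).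
Proof. by move=> /univoqueP[h1 h2]; apply/univoqueP; split=> //; rewrite reflect_seqK. Qed.

Lemma univoque_shift s x n : univoque s x -> univoque s (shift n x).
Proof. by move=> h k; rewrite shiftD; apply: h. Qed.

Lemma univoque_mono s t x : s <= t -> univoque s x -> univoque t x.
Proof.
move=> st /univoqueP[h1 h2]; apply/univoqueP.
by split=> n; apply: lt_le_trans st.
Qed.

End Reflection.
End Lexicographic.

(** * Substituting blocks for the bits of a code *)

Notation bitseq_order := (big_lexi_order (fun _ : nat => bool)).

Section Substitution.
Context {d : Order.disp_t} {T : orderType d}.
Local Notation sq := (big_lexi_order (fun _ : nat => T)).
Variable rev : T -> T.
Variables (m : nat) (a ap : sq).
Local Open Scope order_scope.
Local Notation refl := (reflect_seq rev).
Local Notation bsq := bitseq_order.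
Local Notation refb := (reflect_seq negb).

(** What the argument uses of an admissible word [a] and of [ap], its [a^+]. The
    alphabet is any totally ordered type with a reflection, so that the word
    [10] over the booleans is an instance as well. *)
Record renormalizing_block : Prop := RenormalizingBlock {
  rb_revK : involutive rev;
  rb_rev_lt : forall x y, (rev x < rev y) = (y < x);
  rb_size : (0 < m)%N;
  rb_plus_agree : agree m.-1 ap a;
  rb_plus_gt : a m.-1 < ap m.-1;
  rb_plus_cover : forall c, a m.-1 < c -> ap m.-1 <= c;
  rb_head : rev (a 0%N) < ap 0%N;
  rb_lower : forall i, (0 < i < m)%N -> agree (m - i) (refl a) (shift i a) \/
    exists j, [/\ (j < m - i)%N, agree j (refl a) (shift i a) & rev (a j) < a (i + j)%N];
  rb_upper : forall i, (0 < i < m)%N ->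
    exists j, [/\ (j < m - i)%N, agree j (shift i a) a & a (i + j)%N < a j] }.

(** The block written for the bit [c] when [p] is the bit before it. After [a^+] or
    the reflection of [a] (last bit [true]) the next block is the reflection of
    [a^+] or of [a]; after the other two blocks it is [a] or [a^+]. In both states
    the two candidates differ in the last digit only, by a unit, and the bit
    [true] selects the larger one. *)
Definition sub_block (p c : bool) : sq :=
  if c then (if p then refl a else ap) else (if p then refl ap else a).

Definition previous (p : bool) (c : bsq) (k : nat) : bool :=
  if k is k'.+1 then c k' else p.

Definition subst (p : bool) (c : bsq) : sq :=
  fun i => sub_block (previous p c (i %/ m)) (c (i %/ m)%N) (i %% m)%N.

Hypothesis A : renormalizing_block.
Let m_gt0 : (0 < m)%N := rb_size A.
Let revK := rb_revK A.
Let rev_lt := rb_rev_lt A.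

Lemma rev_le x y : (rev x <= rev y) = (y <= x).
Proof. by rewrite !leNgt rev_lt. Qed.

Lemma reflect_block p c : refl (sub_block p c) = sub_block (~~ p) (~~ c).
Proof. by case: p; case: c => //=; rewrite reflect_seqK. Qed.

Lemma reflect_subst p c : refl (subst p c) = subst (~~ p) (refb c).
Proof.
apply: funext => i; rewrite /subst /reflect_seq.
have -> : previous (~~ p) (fun j => ~~ c j) (i %/ m) = ~~ previous p c (i %/ m).
  by case: (i %/ m)%N.
by rewrite -reflect_block.
Qed.

Lemma subst_at p c k i : (i < m)%N ->
  subst p c (k * m + i)%N = sub_block (previous p c k) (c k) i.
Proof. by move=> im; rewrite /subst divnMDl // modnMDl divn_small // addn0 modn_small. Qed.

Lemma shift_subst p c k : shift (k * m) (subst p c) = subst (previous p c k) (shift k c).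
Proof.
apply: funext => i; rewrite /shift /subst divnMDl // modnMDl.
by case: (i %/ m)%N => [|j] /=; rewrite ?addn0 // addnS.
Qed.

Lemma a_le_ap i : (i < m)%N -> a i <= ap i.
Proof.
move=> im; have [lt_i|ge_i] := ltnP i m.-1; first by rewrite (rb_plus_agree A).
have -> : i = m.-1 by lia.
exact: ltW (rb_plus_gt A).
Qed.

Lemma block_agree p c c' : agree m.-1 (sub_block p c) (sub_block p c').
Proof.
move=> i lti; case: p; case: c; case: c' => //=; rewrite /reflect_seq;
 by rewrite (rb_plus_agree A).
Qed.

Lemma block_last p : sub_block p false m.-1 < sub_block p true m.-1.
Proof. by case: p => /=; rewrite /reflect_seq ?rev_lt (rb_plus_gt A). Qed.

Lemma agree_subst p c c' n : agree n c c' -> agree (n * m) (subst p c) (subst p c').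
Proof.
move=> acc i; rewrite -ltn_divLR // => lti.
rewrite /subst (acc _ lti); congr (sub_block _ _ _).
case: (i %/ m)%N lti => //= k ltk; apply: acc; exact: ltnW.
Qed.

Lemma lt_subst p c c' : (subst p c < subst p c') = (c < c').
Proof.
have h u v : u < v -> subst p u < subst p v.
  move=> /seq_ltP[n [auv lt_uv]]; apply/seq_ltP; exists (n * m + m.-1)%N.
  have lt_m : (m.-1 < m)%N by rewrite prednK.
  split; last first.
    rewrite !subst_at //.
    have -> : previous p u n = previous p v n.
      by case: n auv {lt_uv} => //= n auv; rewrite auv.
    by case: (u n) lt_uv => //; case: (v n) => // _; apply: block_last.
  move=> i lti; case: (ltnP i (n * m)) => [ltin|gein].
    exact: agree_subst auv _ ltin.
  rewrite -(subnKC gein) !subst_at ?ltn_subLR //; try lia.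
  have -> : previous p u n = previous p v n.
    by case: n auv {lt_uv lti gein} => //= n auv; rewrite auv.
  by apply: block_agree; lia.
apply/idP/idP => [lt_s|/h //].
by case: (ltgtP c c') => // [/h|E]; [rewrite ltNge (ltW lt_s)|rewrite E ltxx in lt_s].
Qed.

Lemma le_subst p c c' : (subst p c <= subst p c') = (c <= c').
Proof. by rewrite !leNgt lt_subst. Qed.

Lemma subst_inj p : injective (subst p).
Proof. by move=> c c' E; apply/eqP; rewrite eq_le -!(le_subst p) E lexx. Qed.

(** The last digit of a block tells which of the two candidates it is. *)
Lemma agree_subst_inv p c c' n :
  agree (n * m) (subst p c) (subst p c') -> agree n c c'.
Proof.
move=> acc; elim: n acc => [|n IH] acc i; first by [].
have {}IH : agree n c c' by apply: IH; apply: agree_le acc; lia.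
rewrite ltnS leq_eqVlt => /predU1P[->{i}|/IH //].
have lt_m : (m.-1 < m)%N by rewrite prednK.
have := acc (n * m + m.-1)%N; rewrite !subst_at //.
have -> : previous p c n = previous p c' n.
  by case: n IH {acc} => //= n IH; rewrite IH.
move=> /(_ ltac:(nia)) E; case: (c n) E; case: (c' n) => // E;
by have := block_last (previous p c' n); rewrite E ltxx.
Qed.

Section Shifts.
Variables (p : bool) (c : bsq) (s : sq).
Hypothesis s_ap : agree m s ap.

Let s_eq_a i : (i < m.-1)%N -> s i = a i.
Proof. by move=> lti; rewrite s_ap ?(rb_plus_agree A) //; lia. Qed.

Let in_block k i j : (i < m)%N -> (j < m - i)%N ->
  shift (k * m + i) (subst p c) j = sub_block (previous p c k) (c k) (i + j)%N.
Proof. by move=> im jm; rewrite /shift -addnA subst_at //; lia. Qed.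

Let next_block k i l : (i < m)%N -> (l < m)%N ->
  shift (k * m + i) (subst p c) (m - i + l)%N = sub_block (c k) (c k.+1) l.
Proof.
move=> im jm; rewrite /shift; have -> : (k * m + i + (m - i + l) = k.+1 * m + l)%N by lia.
by rewrite subst_at.
Qed.

Lemma shift_lt_in_block k i j : (0 < i < m)%N -> (j < m - i)%N ->
  (forall l, (l < j)%N -> sub_block (previous p c k) (c k) (i + l)%N = a l) ->
  sub_block (previous p c k) (c k) (i + j)%N < a j ->
  shift (k * m + i) (subst p c) < s.
Proof.
move=> /andP[i0 im] jm h1 h2; apply/seq_ltP; exists j; split.
  by move=> l lj; rewrite in_block ?h1 ?s_eq_a //; lia.
by rewrite in_block // s_eq_a //; lia.
Qed.

Lemma shift_lt_next_block k i : (0 < i < m)%N -> c k ->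
  (forall l, (l < m - i)%N -> sub_block (previous p c k) (c k) (i + l)%N = a l) ->
  shift (k * m + i) (subst p c) < s.
Proof.
move=> /andP[i0 im] ck h1.
have next l : (l < i)%N -> shift (k * m + i) (subst p c) (m - i + l)%N = rev (a l).
  move=> li; rewrite next_block //; last by lia.
  rewrite ck; have -> : sub_block true (c k.+1) l = sub_block true true l.
    by apply: block_agree; lia.
  by [].
have suff_lt l : (l < i)%N -> (forall l', (l' < l)%N -> rev (a l') = s (m - i + l')%N) ->
    rev (a l) < s (m - i + l)%N -> shift (k * m + i) (subst p c) < s.
  move=> li h2 h3; apply/seq_ltP; exists (m - i + l)%N; split; last by rewrite next.
  move=> j ltj; case: (ltnP j (m - i)) => [ltjm|gejm].
    by rewrite in_block // h1 // s_eq_a //; lia.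
  by rewrite -(subnKC gejm) next ?h2 //; lia.
have im' : (0 < m - i < m)%N by lia.
have sE l : (l < i.-1)%N -> s (m - i + l)%N = a (m - i + l)%N.
  by move=> li; rewrite s_eq_a //; lia.
have mi : (m - (m - i) = i)%N by lia.
have le_s l : (l < i)%N -> a (m - i + l)%N <= s (m - i + l)%N.
  by move=> li; rewrite s_ap ?a_le_ap //; lia.
have [agr|[j [ltj agr lt_j]]] := rb_lower A im'.
  rewrite mi in agr; apply: (suff_lt i.-1); first by lia.
    by move=> l li; rewrite sE //; apply: agr; lia.
  have -> : rev (a i.-1) = shift (m - i) a i.-1 by apply: agr; lia.
  rewrite /shift; have -> : (m - i + i.-1 = m.-1)%N by lia.
  by rewrite s_ap ?(rb_plus_gt A) //; lia.
rewrite mi in ltj; apply: (suff_lt j) => //.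
  by move=> l lj; rewrite sE; [apply: agr|lia].
exact: lt_le_trans (le_s _ ltj).
Qed.

(** Admissibility of [a] is exactly what makes the shifts of a substituted
    sequence that start inside a block harmless. *)
Lemma unaligned_shift_lt k i : (0 < i < m)%N -> shift (k * m + i) (subst p c) < s.
Proof.
move=> im; have [i0 i_m] := andP im.
case Ep : (previous p c k); case Ec : (c k).
- (* the block is the reflection of a *)
  have [agr|[j [ltj agr lt_j]]] := rb_lower A im.
    apply: (shift_lt_next_block im) => // l ltl; rewrite Ep Ec /=.
    by rewrite /reflect_seq -[a (i + l)%N](agr l ltl) /reflect_seq revK.
  apply: (@shift_lt_in_block k i j) => //; rewrite Ep Ec /=.
    by move=> l ltl; rewrite /reflect_seq -[a (i + l)%N](agr l ltl) /reflect_seq revK.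
  by rewrite /reflect_seq -[a j]revK rev_lt.
- (* the block is the reflection of a^+ *)
  have [agr|[j [ltj agr lt_j]]] := rb_lower A im.
    apply: (@shift_lt_in_block k i (m.-1 - i)) => //; rewrite ?Ep ?Ec /=; first by lia.
      move=> l ltl; rewrite /reflect_seq (rb_plus_agree A); last by lia.
      by rewrite -[a (i + l)%N](agr l) ?revK //; lia.
    have iE : (i + (m.-1 - i) = m.-1)%N by lia.
    rewrite /reflect_seq iE.
    have -> : a (m.-1 - i)%N = rev (a m.-1).
      by rewrite -{2}iE -[a (i + _)%N](agr (m.-1 - i)%N) ?revK //; lia.
    by rewrite rev_lt (rb_plus_gt A).
  apply: (@shift_lt_in_block k i j) => //; rewrite Ep Ec /=.
    move=> l ltl; rewrite /reflect_seq (rb_plus_agree A); last by lia.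
    by rewrite -[a (i + l)%N](agr l) ?revK //; lia.
  rewrite /reflect_seq -[a j]revK rev_lt; apply: lt_le_trans lt_j _.
  by apply: a_le_ap; lia.
- (* the block is a^+ *)
  have [j [ltj agr lt_j]] := rb_upper A im.
  have hl l : (l < j)%N -> ap (i + l)%N = a l.
    by move=> ltl; rewrite (rb_plus_agree A); [apply: agr|lia].
  case: (ltnP (i + j) m.-1) => [lt_ij|ge_ij].
    apply: (@shift_lt_in_block k i j) => //; rewrite Ep Ec //=.
    by rewrite (rb_plus_agree A).
  have ijE : (i + j = m.-1)%N by lia.
  have : ap (i + j)%N <= a j by rewrite ijE; apply: (rb_plus_cover A); rewrite -ijE.
  rewrite le_eqVlt => /predU1P[E|lt_apj].
    apply: (shift_lt_next_block im) => // l ltl; rewrite Ep Ec /=.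
    by case: (ltnP l j) => [/hl //|gel]; have -> : l = j by lia.
  by apply: (@shift_lt_in_block k i j) => //; rewrite Ep Ec.
- have [j [ltj agr lt_j]] := rb_upper A im.
  by apply: (@shift_lt_in_block k i j) => //; rewrite Ep Ec.
Qed.

(** Among the four blocks, [a^+] is the only one that is not smaller than the first
    block of [s], so that the only delicate shifts are those that start with a
    change of the code from [false] to [true]. *)
Lemma aligned_shift_lt k : previous p c k || ~~ c k -> shift (k * m) (subst p c) < s.
Proof.
move=> h; have lt_m : (m.-1 < m)%N by lia.
have in0 j : (j < m)%N -> shift (k * m) (subst p c) j = sub_block (previous p c k) (c k) j.
  by move=> ltj; rewrite /shift subst_at.
case Ep : (previous p c k) h in0 => [] /= => [_|ck] in0.
  apply: lt_head; rewrite in0 // s_ap //; case: (c k) => /=; rewrite /reflect_seq.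
    exact: rb_head A.
  by apply: le_lt_trans (rb_head A); rewrite rev_le; apply: a_le_ap.
rewrite (negbTE ck) in in0; apply/seq_ltP; exists m.-1; split.
  by move=> i lti; rewrite in0 ?s_eq_a //; lia.
by rewrite in0 //= s_ap // (rb_plus_gt A).
Qed.

Lemma shift_subst_lt n :
  (forall k, (k * m = n)%N -> ~~ previous p c k -> c k -> subst false (shift k c) < s) ->
  shift n (subst p c) < s.
Proof.
move=> h; rewrite (divn_eq n m); case: (posnP (n %% m)) => [r0|r0]; last first.
  by apply: unaligned_shift_lt; rewrite r0 ltn_mod.
rewrite r0 addn0; have [|] := boolP (previous p c (n %/ m) || ~~ c (n %/ m)%N).
  exact: aligned_shift_lt.
rewrite negb_or negbK => /andP[pk ck].
rewrite shift_subst (negbTE pk); apply: h => //.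
by rewrite {2}(divn_eq n m) r0 addn0.
Qed.

End Shifts.

Lemma subst_prefix (c : bsq) : c 0%N -> agree m (subst false c) ap.
Proof. by move=> c0 i im; rewrite -[i]add0n -(mul0n m) subst_at //= c0. Qed.

(** A code yields a univoque sequence as soon as its shifts are below the
    threshold: shifts inside blocks are harmless, and shifts along the code and
    its reflection are controlled by the hypothesis. *)
Lemma univoque_subst p s (c : bsq) : agree m s ap ->
  (forall n, subst false (shift n c) < s /\ subst false (shift n (refb c)) < s) ->
  univoque rev s (subst p c).
Proof.
move=> s_ap h; apply/(univoqueP revK rev_lt); split=> n; rewrite ?reflect_subst;
by apply: shift_subst_lt => // k _ _ _; have [] := h k.
Qed.

Lemma lt_negb (x y : bool) : (~~ x < ~~ y) = (y < x).
Proof. by case: x; case: y. Qed.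

Lemma univoque_subst_bits p (t c : bsq) : t 0%N ->
  univoque negb t c -> univoque rev (subst false t) (subst p c).
Proof.
move=> t0 /(univoqueP negbK lt_negb)[h1 h2]; apply: univoque_subst.
  exact: subst_prefix.
by move=> n; rewrite !lt_subst.
Qed.

Lemma shift1_le_ones (y : bsq) : y 0%N -> shift 1 y <= y.
Proof.
move=> y0; have [all1|] := pselect (forall n, y n).
  have -> : shift 1 y = y by apply: funext => n; rewrite /shift !all1.
  by [].
move=> /existsNP[n0 yn0].
have ex : exists n, ~~ y n by exists n0; apply/negP.
have [n yn min_n] := ex_minnP ex.
have n0' : (0 < n)%N by rewrite lt0n; apply: contraNneq yn => ->.
have ones i : (i < n)%N -> y i.
  by move=> lti; apply: contraTT lti => /min_n; rewrite -leqNgt.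
apply: ltW; apply/seq_ltP; exists n.-1; split.
  by move=> i lti; rewrite /shift !ones //; lia.
by rewrite /shift add1n prednK // (negbTE yn) ones //; lia.
Qed.

(** The hypothesis only bounds the shifts that begin a run of equal bits. Inside a
    run of [true] nothing is lost, since dropping a leading [true] makes a
    sequence smaller. *)
Lemma univoque_subst_inv s (t c : bsq) : c 0%N -> s <= subst false t -> t 0%N ->
  univoque rev s (subst false c) -> univoque negb t c.
Proof.
move=> c0 st t0 /(univoqueP revK rev_lt)[h1 h2].
apply/(univoqueP negbK lt_negb); split.
  suff h n : c n -> shift n c < t.
    move=> n; case cn : (c n); first exact: h.
    by apply: lt_head; rewrite /shift addn0 cn t0.
  elim: n => [|n IH] cn.
    have := h1 0%N; rewrite !shift0 => h; rewrite -(lt_subst false).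
    exact: lt_le_trans st.
  case cn' : (c n).
    apply: le_lt_trans (IH cn'); rewrite -addn1 -shiftD.
    by apply: shift1_le_ones; rewrite /shift addn0.
  have := h1 (n.+1 * m)%N; rewrite shift_subst /= cn' => h.
  by rewrite -(lt_subst false); apply: lt_le_trans st.
suff h n : ~~ c n -> shift n (refb c) < t.
  move=> n; case cn : (c n); last by apply: h; rewrite cn.
  by apply: lt_head; rewrite /shift addn0 /reflect_seq cn t0.
elim: n => [|n IH] cn; first by rewrite c0 in cn.
case cn' : (c n).
  have := h2 (n.+1 * m)%N; rewrite reflect_subst shift_subst /= {1}/reflect_seq cn' => h.
  by rewrite -(lt_subst false); apply: lt_le_trans st.
apply: le_lt_trans (IH _); last by rewrite cn'.
rewrite -addn1 -shiftD; apply: shift1_le_ones.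
by rewrite /shift addn0 /reflect_seq cn'.
Qed.

Definition ones : bsq := fun=> true.
Definition zeros : bsq := fun=> false.

Lemma block_cases (p : bool) x :
  agree m.-1 x (sub_block p false) ->
  sub_block p false m.-1 <= x m.-1 <= sub_block p true m.-1 ->
  exists c, agree m x (sub_block p c).
Proof.
move=> agr /andP[h1 h2].
suff [c E] : exists c, x m.-1 = sub_block p c m.-1.
  exists c => i lti; case: (ltnP i m.-1) => [lti'|gei].
    by rewrite agr //; apply: block_agree.
  by have -> : i = m.-1 by lia.
have [E|ne] := eqVneq (x m.-1) (sub_block p false m.-1); first by exists false.
exists true; apply/eqP; rewrite eq_le h2 /=; have {h1 ne} : sub_block p false m.-1 < x m.-1 by rewrite lt_neqAle eq_sym ne.
case: p {agr h2} => /=; last exact: (rb_plus_cover A).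
rewrite /reflect_seq => h; rewrite -[x _]revK rev_le leNgt.
by apply/negP => /(rb_plus_cover A); rewrite leNgt -rev_lt revK h.
Qed.

(** Below [a^+ (reflect a)^oo] the digits of a univoque sequence are forced,
    block after block, up to a binary choice: the sequence is squeezed between
    two sequences whose current blocks differ in the last digit only, by one. *)
Lemma univoque_decomposition (s x : sq) : s <= subst false ones -> univoque rev s x ->
  agree m x ap -> exists c : bsq, c 0%N /\ x = subst false c.
Proof.
move=> s_ones ux x_ap.
have lt_m : (m.-1 < m)%N by lia.
have hi n : shift n x <= subst false ones.
  by have [_ /ltW h] := ux n; apply: le_trans s_ones.
have lo n : subst true zeros <= shift n x.
  have [/ltW h _] := ux n; apply: le_trans h.
  have -> : subst true zeros = refl (subst false ones) by rewrite reflect_subst.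
  by rewrite (le_reflect revK rev_lt).
have blk_ones p : agree m (subst p ones) (sub_block p true).
  by move=> i im; rewrite -[i]add0n -(mul0n m) subst_at.
have blk_zeros p : agree m (subst p zeros) (sub_block p false).
  by move=> i im; rewrite -[i]add0n -(mul0n m) subst_at.
have sh_ones p : shift m (subst p ones) = subst true ones.
  by rewrite -[m in LHS]mul1n shift_subst.
have sh_zeros p : shift m (subst p zeros) = subst false zeros.
  by rewrite -[m in LHS]mul1n shift_subst.
(* the current bounds only depend on the previous bit of the code *)
pose bounds p y := subst p zeros <= y <= subst p ones.
have step p k : bounds p (shift (k * m) x) ->
    exists c, agree m (shift (k * m) x) (sub_block p c) /\ bounds c (shift (k.+1 * m) x).
  move=> /andP[h1 h2].
  have agr : agree m.-1 (subst p zeros) (subst p ones).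
    move=> i lti; rewrite blk_zeros ?blk_ones; try lia.
    exact: block_agree.
  have [ax /andP[l1 l2]] := agree_squeeze agr h1 h2.
  rewrite blk_zeros // in l1; rewrite blk_ones // in l2.
  have axb : agree m.-1 (shift (k * m) x) (sub_block p false).
    by move=> i lti; rewrite ax // blk_zeros //; lia.
  have l12 : sub_block p false m.-1 <= shift (k * m) x m.-1 <= sub_block p true m.-1.
    by rewrite l1 l2.
  have [c hc] := block_cases axb l12.
  exists c; split=> //; rewrite /bounds mulSn addnC -shiftD.
  case: c hc => hc.
    rewrite -(sh_ones p) le_agree ?h2 ?andbT; last first.
      by move=> i im; rewrite hc // blk_ones.
    by rewrite shiftD.
  rewrite -(sh_zeros p) le_agree ?h1 /=; last first.
    by move=> i im; rewrite hc // blk_zeros.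
  by rewrite shiftD.
have {}step p k : { c | bounds p (shift (k * m) x) ->
    agree m (shift (k * m) x) (sub_block p c) /\ bounds c (shift (k.+1 * m) x) }.
  apply: cid; have [/step[c hc]|nb] := boolP (bounds p (shift (k * m) x)).
    by exists c.
  by exists p.
pose st := fix st k := if k is k'.+1 then sval (step (st k') k') else false.
have inv k : bounds (st k) (shift (k * m) x).
  elim: k => [|k IH] /=; last by case: (step _ _) => c /= /(_ IH)[].
  rewrite mul0n shift0 /bounds -{2}(shift0 x) hi andbT.
  apply: ltW; apply/seq_ltP; exists m.-1; split.
    move=> i lti; rewrite blk_zeros ?x_ap; try lia.
    by rewrite (rb_plus_agree A).
  by rewrite blk_zeros //= x_ap // (rb_plus_gt A).
have st_blk k : agree m (shift (k * m) x) (sub_block (st k) (st k.+1)).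
  by move=> /=; case: (step _ _) => c /= /(_ (inv k))[].
exists (fun k => st k.+1); split.
  have := st_blk 0%N; rewrite mul0n shift0 => /(_ _ lt_m).
  rewrite x_ap //; case: (st 1%N) => // E.
  by have := rb_plus_gt A; rewrite E ltxx.
apply: funext => i; rewrite {1}(divn_eq i m) /subst -/(shift _ _ _) st_blk ?ltn_mod //.
by congr sub_block; case: (i %/ m)%N.
Qed.

Lemma subst_le_self (t : bsq) : t 0%N -> (forall n, shift n t <= t) ->
  forall n, shift n (subst false t) <= subst false t.
Proof.
move=> t0 ht n; have [->|/eqP nE] := eqVneq (shift n (subst false t)) (subst false t); first by [].
rewrite (divn_eq n m); case: (posnP (n %% m)) => [r0|r0]; last first.
  by apply/ltW/unaligned_shift_lt; [exact: subst_prefix|rewrite r0 ltn_mod].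
rewrite r0 addn0.
have [|] := boolP (previous false t (n %/ m) || ~~ t (n %/ m)%N).
  by move=> h; apply/ltW/aligned_shift_lt => //; exact: subst_prefix.
rewrite negb_or negbK => /andP[pk ck].
by rewrite shift_subst (negbTE pk) le_subst.
Qed.

End Substitution.

(** * The doubling substitution and the Thue-Morse sequence *)

Lemma countable_inj {U W : Type} (f : U -> W) (X : set U) (Y : set W) :
  {in X &, injective f} -> (forall x, X x -> Y (f x)) -> countable Y -> countable X.
Proof.
move=> fi fXY /countable_injP[g gi]; apply/countable_injP; exists (g \o f).
move=> x y xX yX /= /gi E; apply: fi => //; apply: E; apply/mem_set/fXY;
exact: set_mem.
Qed.

Lemma countable_setU {U : Type} (X Y : set U) :
  countable X -> countable Y -> countable (X `|` Y).
Proof.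
move=> cX cY.
have -> : X `|` Y = \bigcup_(b in [set: bool]) (if b then X else Y).
  apply/seteqP; split=> [x [Xx|Yx]|x [[] _ /= Xx]]; [| |by left|by right].
    by exists true.
  by exists false.
by apply: bigcup_countable => // -[].
Qed.

Section Doubling.
Local Open Scope order_scope.
Local Notation bsq := bitseq_order.
Local Notation refb := (reflect_seq negb).

Definition word10 : bsq := fun i => i == 0%N.

Definition double : bsq -> bsq := subst negb 2 word10 ones false.

(** The theory of blocks thus applies to binary sequences themselves, with the
    word [10]: the blocks are [11], [01], [00] and [10]. *)
Lemma block10 : renormalizing_block negb 2 word10 ones.
Proof.
split=> //; first exact: negbK.
- by case; case.
- by case.
- move=> i hi; have -> : i = 1%N by lia.
  by left => -[].
- move=> i hi; have -> : i = 1%N by lia.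
  by exists 0%N.
Qed.
Hint Resolve block10 : core.

Implicit Types (c t x y : bsq).

Lemma double_even c i : double c (i * 2)%N = ~~ previous false c i.
Proof.
rewrite -[(i * 2)%N]addn0 /double subst_at //.
by case: (previous _ _ _); case: (c i).
Qed.

Lemma double_odd c i : double c (i * 2 + 1)%N = c i.
Proof. by rewrite /double subst_at //; case: (previous _ _ _); case: (c i). Qed.

Lemma double0 c : double c 0%N.
Proof. by have := double_even c 0. Qed.

Lemma double1 c : double c 1%N = c 0%N.
Proof. exact: (double_odd c 0). Qed.

Lemma lt_double c c' : (double c < double c') = (c < c').
Proof. exact: lt_subst. Qed.

Lemma le_double c c' : (double c <= double c') = (c <= c').
Proof. exact: le_subst. Qed.

Lemma agree_double n c c' : agree n c c' -> agree (n * 2) (double c) (double c').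
Proof. exact: agree_subst. Qed.

Lemma agree_iter_double k c c' : c 0%N = c' 0%N ->
  agree (2 ^ k) (iter k double c) (iter k double c').
Proof.
move=> E; elim: k => [|k IH] /=; first by rewrite expn0 => -[].
by rewrite expnSr; apply: agree_double.
Qed.

Lemma iter_double0 k c : c 0%N -> iter k double c 0%N.
Proof. by case: k => //= k _; apply: double0. Qed.

(** The (shifted) Thue-Morse sequence [1101 0011 ...]. The [k]-th iterate of [double]
    has its first [2 ^ k] digits settled, and [i < 2 ^ i]. *)
Definition thue_morse : bsq := fun i => iter i double ones i.

Lemma agree_thue_morse k c : c 0%N -> agree (2 ^ k) (iter k double c) thue_morse.
Proof.
move=> c0 i lti; rewrite /thue_morse.
have h u v : (i < 2 ^ u)%N -> (i < 2 ^ v)%N -> (u <= v)%N ->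
    iter u double ones i = iter v double ones i.
  move=> hu hv uv; rewrite -(subnKC uv) iterD.
  by rewrite (@agree_iter_double u _ ones) // iter_double0.
rewrite (@agree_iter_double k _ ones) //.
have hi : (i < 2 ^ i)%N by apply: ltn_expl.
by case: (leqP k i) => [ki|/ltnW ik]; [apply: h|apply/esym/h].
Qed.

Lemma double_thue_morse : double thue_morse = thue_morse.
Proof.
apply: funext => i.
have hi : (i < 2 ^ i)%N by apply: ltn_expl.
rewrite -(@agree_double (2 ^ i) (iter i double ones)).
- rewrite -[double (iter i double ones)]/(iter i.+1 double ones).
  by apply: agree_thue_morse => //; rewrite expnS; lia.
- exact: agree_thue_morse.
- lia.
Qed.

Lemma thue_morse0 : thue_morse 0%N. Proof. by []. Qed.

Lemma thue_morse1 : thue_morse 1%N.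
Proof. by rewrite -double_thue_morse double1. Qed.

Lemma thue_morse_even i : thue_morse (i * 2)%N = ~~ previous false thue_morse i.
Proof. by rewrite -{1}double_thue_morse double_even. Qed.

Lemma thue_morse_odd i : thue_morse (i * 2 + 1)%N = thue_morse i.
Proof. by rewrite -{1}double_thue_morse double_odd. Qed.

Lemma thue_morse_pow2 k : thue_morse (2 ^ k).-1.
Proof.
elim: k => [|k IH] //.
have -> : ((2 ^ k.+1).-1 = (2 ^ k).-1 * 2 + 1)%N.
  by have := expn_gt0 2 k; rewrite expnS; lia.
by rewrite thue_morse_odd.
Qed.

Lemma thue_morse_half k j : (j < (2 ^ k).-1)%N ->
  thue_morse (2 ^ k + j)%N = ~~ thue_morse j.
Proof.
elim: k j => [|k IH] j ltj; first by rewrite expn0 in ltj.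
have p2 := expn_gt0 2 k; rewrite expnS in ltj *.
have jE := divn_eq j 2; move: (j %/ 2)%N (j %% 2)%N (ltn_pmod j (isT : (0 < 2)%N)) jE.
move=> l [|[|//]] _ jE.
  rewrite jE addn0; have -> : (2 * 2 ^ k + l * 2 = (2 ^ k + l) * 2)%N by lia.
  rewrite !thue_morse_even; case: l jE => [|l] jE /=; last by rewrite addnS /= IH //; lia.
  have -> : (2 ^ k + 0 = (2 ^ k).-1.+1)%N by lia.
  by rewrite /= thue_morse_pow2.
rewrite jE; have -> : (2 * 2 ^ k + (l * 2 + 1) = (2 ^ k + l) * 2 + 1)%N by lia.
by rewrite !thue_morse_odd IH //; lia.
Qed.

Definition golden : bsq := fun i => ~~ odd i.

Lemma lt_of_no_square (x t : bsq) : t 0%N -> t 1%N -> ~~ (x 0%N && x 1%N) -> x < t.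
Proof.
move=> t0 t1; case x0 : (x 0%N) => /= x1; last by apply: lt_head; rewrite x0 t0.
by apply/seq_ltP; exists 1%N; rewrite t1 (negbTE x1); split=> // -[] //; rewrite x0 t0.
Qed.

Lemma no_square_of_lt_golden n (x : bsq) : shift n x < golden -> x n -> ~~ x n.+1.
Proof.
move=> lt_x xn.
have x0 : shift n x 0%N = golden 0%N by rewrite /shift addn0 xn.
move: lt_x; rewrite -(lt_behead x0) => /ltW /le_head.
by rewrite /shift addn0 addn1; case: (x n.+1).
Qed.

Lemma alternating (x : bsq) : x 0%N -> (forall n, x n.+1 = ~~ x n) -> x = golden.
Proof.
move=> x0 h; apply: funext; elim=> [|n IH]; first by rewrite x0.
by rewrite h IH.
Qed.

Lemma refbK : involutive refb.
Proof. exact: reflect_seqK negbK. Qed.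

(** Below [(10)^oo] a univoque sequence contains neither [11] nor, by reflection,
    [00]. Hence it alternates, and one of its shifts is [(10)^oo] itself. *)
Lemma univoque_golden x : ~ univoque negb golden x.
Proof.
have main (y : bsq) : y 0%N -> ~ univoque negb golden y.
  move=> y0 /(univoqueP negbK lt_negb)[h1 h2].
  have yE : y = golden.
    apply: alternating => // n; case yn : (y n).
      exact/negbTE/(@no_square_of_lt_golden n).
    by have := @no_square_of_lt_golden n (refb y) (h2 n); rewrite /reflect_seq yn negbK; apply.
  by have := h1 0%N; rewrite shift0 yE ltxx.
case x0 : (x 0%N); first exact: main.
move/(univoque_reflect negbK lt_negb); apply: main.
by rewrite /reflect_seq x0.
Qed.

(** Once [11] occurs, the rest of the sequence decomposes into blocks of the word
    [10], and its code is univoque for the threshold [t] one level below; the case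
    of [00] is symmetric, and otherwise the sequence alternates. *)
Lemma univoque_double_cases t x : t 0%N -> univoque negb (double t) x ->
  [\/ x = golden, x = refb golden,
      exists n, exists2 c, univoque negb t c & shift n x = double c |
      exists n, exists2 c, univoque negb t c & shift n (refb x) = double c].
Proof.
move=> t0 ux.
have renorm (y : bsq) n : univoque negb (double t) y -> y n -> y n.+1 ->
    exists n, exists2 c, univoque negb t c & shift n y = double c.
  move=> uy yn yn1; exists n.
  have [||c [c0 E]] := univoque_decomposition block10 _ (univoque_shift n uy).
  - rewrite (le_subst block10) leNgt; apply/negP => /seq_ltP[k [_]].
    by case: (t k).
  - by move=> [|[|//]] _; rewrite /shift ?addn0 ?addn1 ?yn ?yn1.
  exists c => //; apply: (univoque_subst_inv block10 c0) t0 _; first exact: lexx.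
  by rewrite -E; apply: univoque_shift.
have [[n [xn xn1]]|no11] := pselect (exists n, x n /\ x n.+1).
  by constructor 3; apply: (renorm x n).
have [[n [xn xn1]]|no00] := pselect (exists n, ~~ x n /\ ~~ x n.+1).
  constructor 4; apply: (renorm (refb x) n) => //.
  exact: univoque_reflect negbK lt_negb _ _ _.
have alt n : x n.+1 = ~~ x n.
  case xn : (x n); case xn1 : (x n.+1) => //.
    by case: no11; exists n; rewrite xn xn1.
  by case: no00; exists n; rewrite xn xn1.
case x0 : (x 0%N); first by constructor 1; apply: alternating.
constructor 2; rewrite -[x]refbK; congr (refb _); apply: alternating.
  by rewrite /reflect_seq x0.
by move=> n; rewrite /reflect_seq alt.
Qed.

Lemma univoque_double_golden x : x 0%N -> univoque negb (double golden) x -> x = golden.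
Proof.
move=> x0 /univoque_double_cases[//|//|E|[n [c /univoque_golden//]]|[n [c /univoque_golden//]]].
by rewrite E in x0.
Qed.

Lemma countable_shift (X : set bsq) n : countable X -> countable [set x : bsq | X (shift n x)].
Proof.
move=> cX; apply: (@countable_inj _ _ (fun x : bsq => (mkseq x n, shift n x)) _ ([set: seq bool] `*` X)).
- move=> x y _ _ [E1 E2]; apply: funext => i; case: (ltnP i n) => lti.
    by rewrite -(nth_mkseq false x lti) E1 nth_mkseq.
  by have := congr1 (fun f => f (i - n)%N) E2; rewrite /shift subnKC.
- by move=> x.
- exact: countableX.
Qed.

Lemma countable_univoque_double k : countable (univoque negb (iter k double golden)).
Proof.
elim: k => [|k IH] /=.
  by rewrite (_ : univoque _ _ = set0) //; apply/seteqP; split=> // x /univoque_golden.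
set X := univoque _ _ in IH.
pose Z := [set x | exists2 c, X c & x = double c].
have cZ : countable Z.
  have -> : Z = double @` X.
    by apply/seteqP; split=> x [c Xc E]; exists c.
  by apply: sub_countable IH; apply: card_image_le.
pose Z1 := \bigcup_(n in [set: nat]) [set x : bsq | Z (shift n x)].
have cZ1 : countable Z1.
  by apply: bigcup_countable => // n _; apply: countable_shift.
have cZ2 : countable [set x | Z1 (refb x)].
  apply: (@countable_inj _ _ refb _ Z1) => //.
  by move=> x y _ _ /(can_inj refbK).
apply: (@sub_countable _ _ _ ((Z1 `|` [set x | Z1 (refb x)]) `|` [set golden; refb golden])).
  apply: subset_card_le => x /univoque_double_cases[].
  - exact: iter_double0.
  - by move=> ->; right; left.
  - by move=> ->; right; right.
  - by move=> [n [c cX E]]; left; left; exists n => //; exists c.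
  - by move=> [n [c cX E]]; left; right; exists n => //; exists c.
apply: countable_setU; first exact: countable_setU.
by apply: countable_setU.
Qed.

Definition prefix10 (k : nat) (x : bsq) : bsq :=
  fun i => if (i < k * 2)%N then ~~ odd i else x (i - k * 2)%N.

Lemma prefix10_0 (c : nat) x : x 0%N -> prefix10 c x 0%N.
Proof. by rewrite /prefix10; case: c. Qed.

Lemma shift_prefix10 (c : nat) x n : (c * 2 <= n)%N -> shift n (prefix10 c x) = shift (n - c * 2) x.
Proof.
move=> cn; apply: funext => i; rewrite /shift /prefix10 ifF; last by lia.
by congr x; lia.
Qed.

Lemma prefix10_no_square (c : nat) x n : x 0%N -> (n < c * 2)%N ->
  prefix10 c x n.+1 = ~~ prefix10 c x n.
Proof.
move=> x0 nc; rewrite /prefix10 nc /=; case: (ltnP n.+1 (c * 2)) => // cn.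
have -> : (n.+1 - c * 2 = 0)%N by lia.
rewrite x0 negbK; lia.
Qed.

Lemma shift_prefix10_lt (c : nat) x t n : t 0%N -> t 1%N -> x 0%N -> (n < c * 2)%N ->
  shift n (prefix10 c x) < t /\ shift n (refb (prefix10 c x)) < t.
Proof.
move=> t0 t1 x0 nc; split; apply: lt_of_no_square => //;
rewrite /shift /reflect_seq addn0 addn1 prefix10_no_square //;
by case: (prefix10 c x n).
Qed.

Lemma agree_prefix10 (c : nat) (x y : bsq) n : agree n x y -> agree (c * 2 + n) (prefix10 c x) (prefix10 c y).
Proof. by move=> axy i lti; rewrite /prefix10; case: ifP => // ci; apply: axy; lia. Qed.

Lemma shift_golden n : shift n golden = golden \/ shift n golden = refb golden.
Proof.
case on : (odd n); [right|left]; apply: funext => i;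
by rewrite /shift /golden /reflect_seq oddD on; case: (odd i).
Qed.

Lemma reflect_golden_lt : refb golden < golden.
Proof. exact: lt_head. Qed.

Lemma shift_golden_le n : shift n golden <= golden /\ shift n (refb golden) <= golden.
Proof.
have -> : shift n (refb golden) = refb (shift n golden) by [].
have h := ltW reflect_golden_lt.
by case: (shift_golden n) => ->; [|rewrite refbK]; split.
Qed.

Lemma reflect_double_golden : refb (double golden) = shift 2 (double golden).
Proof.
apply: funext => i; rewrite /shift addnC (divn_eq i 2) -addnA [(_ %% _ + 2)%N]addnC addnA.
have -> : (i %/ 2 * 2 + 2 = (i %/ 2).+1 * 2)%N by lia.
move: (i %/ 2)%N (i %% 2)%N (ltn_pmod i (isT : (0 < 2)%N)) => l [|[|//]] _.
  rewrite !addn0 /reflect_seq !double_even /=; case: l => //= l.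
by rewrite /reflect_seq !double_odd.
Qed.

Lemma shift_double_golden_le n :
  shift n (double golden) <= double golden /\ shift n (refb (double golden)) <= double golden.
Proof.
have h k : shift k (double golden) <= double golden.
  apply: (subst_le_self block10) => // j; exact: (shift_golden_le j).1.
by split=> //; rewrite reflect_double_golden shiftD.
Qed.

Lemma shift_prefix10_double_golden_le (c : nat) n :
  shift n (prefix10 c (double golden)) <= double golden /\
  shift n (refb (prefix10 c (double golden))) <= double golden.
Proof.
have [nc|cn] := ltnP n (c * 2).
  have [] := shift_prefix10_lt (double0 golden) (double1 golden) (double0 golden) nc.
  by move=> /ltW h1 /ltW h2.
have -> : shift n (refb (prefix10 c (double golden))) = refb (shift n (prefix10 c (double golden))).
  by [].
rewrite shift_prefix10 //; exact: shift_double_golden_le.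
Qed.

Lemma prefix10_double_golden_inj : injective (fun k : nat => prefix10 k (double golden)).
Proof.
move=> c c' E.
have h (u v : nat) : (u < v)%N -> prefix10 u (double golden) <> prefix10 v (double golden).
  move=> uv /(congr1 (fun f : bsq => f (u * 2 + 1)%N)); rewrite /prefix10.
  rewrite ifF; last by lia.
  rewrite ifT; last by lia.
  have -> : (u * 2 + 1 - u * 2 = 1)%N by lia.
  by rewrite double1 oddD oddM andbF.
by case: (ltngtP c c') => // /h; rewrite E.
Qed.

(** At the [n]-th level of a nested substitution the bit [b n] chooses between the
    prefixes [10] and [1010]. Both are smaller than [11], which makes the result
    strictly smaller than the Thue-Morse sequence at every level. The first
    argument is the depth of the nesting. *)
Fixpoint nested (n : nat) (b : nat -> bool) : bsq :=
  if n is n'.+1 then prefix10 (1 + b 0%N) (double (nested n' (fun i => b i.+1))) else ones.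

Definition nested_limit (b : nat -> bool) : bsq := fun i => nested i.+1 b i.

Lemma agree_nested k n n' b : (k <= n)%N -> (k <= n')%N -> agree k (nested n b) (nested n' b).
Proof.
elim: k n n' b => [|k IH] [|n] [|n'] b // kn kn'.
rewrite [nested n.+1 _]/= [nested n'.+1 _]/=.
apply: (agree_le (m := (1 + b 0%N) * 2 + k * 2)); first by lia.
exact/agree_prefix10/agree_double/IH.
Qed.

Lemma nested_limitE b :
  nested_limit b = prefix10 (1 + b 0%N) (double (nested_limit (fun i => b i.+1))).
Proof.
apply: funext => i; rewrite /nested_limit [nested i.+1 _]/=.
apply: (agree_prefix10 (n := i * 2)); last by lia.
apply: agree_double => j ji; exact: (@agree_nested j.+1).
Qed.

(** A shift into the substituted part is compared with the Thue-Morse sequence, a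
    fixed point of [double], by comparing the codes; the corresponding shift of the
    code is shorter, whence an induction on the length of the shift. *)
Lemma univoque_nested b : univoque negb thue_morse (nested_limit b).
Proof.
apply/(univoqueP negbK lt_negb).
suff h n : forall b, shift n (nested_limit b) < thue_morse /\
                     shift n (refb (nested_limit b)) < thue_morse.
  by split=> n; have [] := h n b.
elim/ltn_ind: n => n IH {}b; rewrite nested_limitE.
set c := (1 + _)%N; set y := nested_limit _.
have [nc|cn] := ltnP n (c * 2); first exact: shift_prefix10_lt thue_morse0 thue_morse1 _ nc.
have -> : shift n (refb (prefix10 c (double y))) = refb (shift n (prefix10 c (double y))).
  by [].
rewrite shift_prefix10 //.
have -> : refb (shift (n - c * 2) (double y)) = shift (n - c * 2) (refb (double y)) by [].
have tm2 : agree 2 thue_morse ones by case=> [|[|//]] _; rewrite ?thue_morse0 ?thue_morse1.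
rewrite (reflect_subst block10); split; apply: (shift_subst_lt block10) => // k kn _ _;
rewrite -double_thue_morse [X in X < _]/(double _) lt_double;
by have c0 : (0 < c)%N := isT; case: (IH k ltac:(lia) (fun i => b i.+1)).
Qed.

Lemma nested_limit0 b : nested_limit b 0%N.
Proof. by rewrite nested_limitE prefix10_0 // double0. Qed.

Lemma nested_limit_inj : injective nested_limit.
Proof.
have h b : b 0%N = ~~ nested_limit b 3%N.
  rewrite nested_limitE /prefix10; by case: (b 0%N).
move=> b b' E; apply: funext => n; elim: n b b' E => [|n IH] b b' E; first by rewrite !h E.
have E0 : b 0%N = b' 0%N by rewrite !h E.
apply: (IH (fun i => b i.+1) (fun i => b' i.+1)).
move: E; rewrite nested_limitE [RHS]nested_limitE -E0 => /(congr1 (shift ((1 + b 0%N) * 2))).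
by rewrite !shift_prefix10 // subnn !shift0 => /(subst_inj block10).
Qed.

Lemma uncountable_bits : ~ countable [set: nat -> bool].
Proof.
move=> /countable_injP[f fi].
have {}fi x y : f x = f y -> x = y by apply: fi; rewrite in_setT.
(* Cantor's diagonal *)
pose b n := `[< exists2 x : nat -> bool, f x = n & ~~ x n >].
case E : (b (f b)).
  by move: (E) => /asboolP[x /fi ->]; rewrite E.
by move/asboolPn: E (E) => + /negbT E; apply; exists b.
Qed.

Lemma uncountable_univoque_thue_morse :
  ~ countable [set x | univoque negb thue_morse x /\ x 0%N].
Proof.
move=> h; apply: uncountable_bits; apply: (@countable_inj _ _ nested_limit _ _ _ _ h).
  by move=> b b' _ _ /nested_limit_inj.
by move=> b _; split; [apply: univoque_nested|apply: nested_limit0].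
Qed.

End Doubling.

(** * Binary sequences of prescribed growth from a symmetric expanding map *)

Section Expansion.
Context {R : realType}.
Local Notation bsq := bitseq_order.
Local Notation refb := (reflect_seq negb).

Lemma pow_unbounded (b C : R) : 1 < b -> exists n, C < b ^+ n.
Proof.
move=> b1; have bern n : 1 + n%:R * (b - 1) <= b ^+ n.
  elim: n => [|n IH]; first by rewrite mul0r addr0 expr0.
  rewrite exprS -natr1; apply: (@le_trans _ _ (b * (1 + n%:R * (b - 1)))); last first.
    by rewrite ler_pM2l //; lra.
  have := mulr_ge0 (ler0n R n) (sqr_ge0 (b - 1)); lra.
have [n hn] : exists n : nat, C / (b - 1) < n%:R.
  exists (Num.truncn (C / (b - 1))).+1; exact: truncnS_gt.
exists n; apply: lt_le_trans (bern n); rewrite ltr_pdivrMr in hn; last by lra.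
by lra.
Qed.

Lemma avoid_countable (X : set R) (u v : R) : countable X -> u < v ->
  exists x, [/\ u < x, x < v & ~ X x].
Proof.
move=> cX uv; apply: contrapT => /forallNP h.
have cI : countable `]u, v[%classic.
  apply: sub_countable cX; apply: subset_card_le => x /=; rewrite in_itv /= => /andP[ux xv].
  by apply: contrapT => nX; apply: (h x).
have := countable_lebesgue_measure0 cI.
rewrite lebesgue_measure_itv /= lte_fin uv => /eqP; rewrite eqe subr_eq0 => /eqP E.
by rewrite E ltxx in uv.
Qed.

Lemma countable_roots (p : {poly R}) : p != 0 -> countable [set x | root p x].
Proof.
elim: (size p) {-2}p (leqnn (size p)) => [|n IH] {}p sz p0.
  by move: p0; rewrite -size_poly_eq0 -leqn0 sz.
have [[x /= rx]|no] := pselect (exists x, root p x); last first.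
  rewrite (_ : [set _ | _] = set0) //; apply/seteqP; split=> // x rx.
  by case: no; exists x.
have [q pE] := factor_theorem _ _ rx.
have q0 : q != 0 by apply: contraNneq p0 => q0; rewrite pE q0 mul0r.
have szq : (size q <= n)%N.
  by move: sz; rewrite pE size_Mmonic ?monicXsubC // size_XsubC addn2.
have cq := IH q szq q0.
apply: (@sub_countable _ _ _ ([set x | root q x] `|` [set x])); last exact: countable_setU.
apply: subset_card_le => y /=; rewrite pE rootM root_XsubC => /orP[|/eqP->].
  by left.
by right.
Qed.

Section SignMap.
Variable b : R.
Hypotheses (b_gt1 : 1 < b) (b_le2 : b <= 2).

(** On [-1, 1] this map is odd away from [0], and its two branches have slope [b].
    Generic points have univoque itineraries for the threshold given by the
    itinerary of [1], and the constant slope makes the number of words grow like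
    [b ^ n]. *)
Definition sign_map (x : R) : R := b * x - (if 0 <= x then 1 else -1).

Definition itinerary (x : R) : bsq := fun n => 0 <= iter n sign_map x.

(** An orbit that avoids the discontinuity has an itinerary that is compatible with
    the symmetry. *)
Definition generic (x : R) : Prop := forall n, iter n sign_map x != 0.

Let b_gt0 : 0 < b. Proof. exact: lt_trans b_gt1. Qed.

Let scale_pos (y : R) : 0 <= y -> y <= b * y <= 2 * y.
Proof.
move=> y0; rewrite (ler_wpM2r y0 b_le2) andbT -{1}[y]mul1r.
by rewrite ler_wpM2r // ltW.
Qed.

Let scale_neg (y : R) : y <= 0 -> 2 * y <= b * y <= y.
Proof.
move=> y0; rewrite (ler_wnM2r y0 b_le2) /= -{2}[y]mul1r.
by rewrite ler_wnM2r // ltW.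
Qed.

Implicit Types (x y l r : R).

Lemma sign_map_pos x : 0 <= x -> sign_map x = b * x - 1.
Proof. by rewrite /sign_map => ->. Qed.

Lemma sign_map_neg x : x < 0 -> sign_map x = b * x + 1.
Proof. by rewrite /sign_map ltNge => /negbTE ->; rewrite opprK. Qed.

Lemma shift_itinerary n x : shift n (itinerary x) = itinerary (iter n sign_map x).
Proof. by apply: funext => i; rewrite /shift /itinerary addnC iterD. Qed.

Lemma iter_sign_map_bound n x : -1 <= x <= 1 -> -1 <= iter n sign_map x <= 1.
Proof.
move=> hx; elim: n => //= n; move: (iter n sign_map x) => y /andP[h1 h2].
have [y0|y0] := leP 0 y.
  by rewrite sign_map_pos //; have := scale_pos y0; lra.
by rewrite sign_map_neg //; have := scale_neg (ltW y0); lra.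
Qed.

Lemma iter_sign_map_sub n x y : agree n (itinerary x) (itinerary y) ->
  iter n sign_map y - iter n sign_map x = b ^+ n * (y - x).
Proof.
elim: n => [|n IH] axy /=; first by rewrite expr0 mul1r.
have {}IH := IH (agree_le (leqnSn n) axy).
have := axy n (ltnSn n); rewrite /itinerary /sign_map => ->.
by rewrite exprS -mulrA -IH; ring.
Qed.

(** As long as two points have the same signs their distance is multiplied by [b],
    so the signs become different; at that time the order is still the initial
    one. *)
Lemma itinerary_lt x y : -1 <= x <= 1 -> -1 <= y <= 1 -> x < y ->
  (itinerary x < itinerary y)%O.
Proof.
move=> hx hy xy.
have [|N hN] := @pow_unbounded b (2 / (y - x)); first by [].
have [axy|] := pselect (forall n, itinerary x n = itinerary y n).
  have := @iter_sign_map_sub N x y (fun i _ => axy i).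
  have := iter_sign_map_bound N hx; have := iter_sign_map_bound N hy.
  move: (iter N _ y) (iter N _ x) => u v; rewrite ltr_pdivrMr in hN; last by lra.
  by move=> /andP[h1 h2] /andP[h3 h4] E; exfalso; lra.
move=> /existsNP[n0 /eqP ne0].
have ex : exists n, itinerary x n != itinerary y n by exists n0.
have [n ne min_n] := ex_minnP ex.
have axy : agree n (itinerary x) (itinerary y).
  by move=> i lti; apply/eqP; apply: contraTT lti => /min_n; rewrite -leqNgt.
apply/seq_ltP; exists n; split=> //.
have := iter_sign_map_sub axy; move: ne; rewrite /itinerary.
have : 0 < b ^+ n * (y - x) by rewrite mulr_gt0 ?exprn_gt0 ?subr_gt0.
move: (iter n _ y) (iter n _ x) => u v pos.
by case: (leP 0 v); case: (leP 0 u) => // h1 h2 _ E; exfalso; lra.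
Qed.

Lemma itinerary_le x y : -1 <= x <= 1 -> -1 <= y <= 1 -> x <= y ->
  (itinerary x <= itinerary y)%O.
Proof.
move=> hx hy; rewrite le_eqVlt => /predU1P[->|/itinerary_lt h]; first exact: lexx.
exact/ltW/h.
Qed.

Lemma iter_sign_mapN n x : generic x -> iter n sign_map (- x) = - iter n sign_map x.
Proof.
move=> gx; elim: n => //= n ->; move: (gx n); move: (iter n _ x) => y y0.
by rewrite /sign_map oppr_ge0; case: (ltgtP y 0) y0 => // _ _; ring.
Qed.

Lemma itineraryN x : generic x -> itinerary (- x) = refb (itinerary x).
Proof.
move=> gx; apply: funext => n; rewrite /itinerary /reflect_seq iter_sign_mapN //.
by rewrite oppr_ge0 -ltNge lt_neqAle (gx n).
Qed.

Lemma generic_iter n x : generic x -> generic (iter n sign_map x).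
Proof. by move=> gx k; rewrite -iterD. Qed.

Lemma iter_sign_map_lt1 n x : generic x -> -1 < x < 1 -> -1 < iter n sign_map x < 1.
Proof.
move=> gx hx; elim: n => //= n; move: (gx n); move: (iter n sign_map x) => y y0 /andP[h1 h2].
case: (ltgtP y 0) y0 => // y0 _.
  by rewrite sign_map_neg //; have := scale_neg (ltW y0); lra.
by rewrite sign_map_pos ?ltW //; have := scale_pos (ltW y0); lra.
Qed.

Definition kneading : bsq := itinerary 1.

Let one_in : (-1 <= 1 :> R) && (1 <= 1 :> R).
Proof. by rewrite lexx andbT; lra. Qed.

Lemma univoque_itinerary x : generic x -> -1 < x < 1 ->
  univoque negb kneading (itinerary x).
Proof.
move=> gx hx; apply/(univoqueP negbK lt_negb).
have main n : (shift n (itinerary x) < kneading)%O /\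
              (shift n (refb (itinerary x)) < kneading)%O.
  have -> : shift n (refb (itinerary x)) = refb (shift n (itinerary x)) by [].
  rewrite shift_itinerary -itineraryN; last exact: generic_iter.
  have /andP[h1 h2] := iter_sign_map_lt1 n gx hx.
  by split; apply: itinerary_lt => //; lra.
by split=> n; case: (main n).
Qed.

Lemma shift_kneading_le n : generic 1 ->
  (shift n kneading <= kneading)%O /\ (shift n (refb kneading) <= kneading)%O.
Proof.
move=> g1; have -> : shift n (refb kneading) = refb (shift n kneading) by [].
rewrite shift_itinerary -itineraryN; last exact: generic_iter.
have /andP[h1 h2] := iter_sign_map_bound n one_in.
by split; apply: itinerary_le => //; lra.
Qed.

Lemma kneading0 : kneading 0%N.
Proof. by rewrite /kneading /itinerary /=. Qed.

(** A point that reaches [0] is determined by the time this takes and the signs met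
    before. *)
Lemma countable_nongeneric : countable [set x | ~ generic x].
Proof.
have ex x : exists n, ~ generic x -> iter n sign_map x = 0.
  have [g|/existsNP[n /negP]] := pselect (generic x); first by exists 0%N.
  by rewrite negbK => /eqP E; exists n.
pose N x := sval (cid (ex x)).
have NE x : ~ generic x -> iter (N x) sign_map x = 0 by rewrite /N; case: cid.
apply: (@countable_inj _ _ (fun x => (N x, mkseq (itinerary x) (N x))) _ setT) => //.
move=> x y /set_mem /= gx /set_mem /= gy [EN Emk].
have axy : agree (N x) (itinerary x) (itinerary y).
  by move=> i lti; rewrite -(nth_mkseq false (itinerary x) lti) Emk nth_mkseq -?EN.
have := iter_sign_map_sub axy; rewrite {1}EN !NE // subr0 => /esym/eqP.
rewrite mulf_eq0 expf_eq0 (gt_eqF b_gt0) andbF subr_eq0 /= => /eqP -> //.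
Qed.

Lemma itinerary_inj x y : -1 <= x <= 1 -> -1 <= y <= 1 -> itinerary x = itinerary y -> x = y.
Proof.
move=> hx hy E; case: (ltgtP x y) => // /itinerary_lt h.
  by have := h hx hy; rewrite E ltxx.
by have := h hy hx; rewrite E ltxx.
Qed.

(** Distinct generic points have distinct itineraries, all of them univoque. *)
Lemma uncountable_univoque_kneading : ~ countable (univoque negb kneading).
Proof.
move=> cV.
have c1 : countable [set x | generic x /\ -1 < x < 1].
  apply: (@countable_inj _ _ itinerary _ _ _ _ cV).
    move=> x y /set_mem[_ /andP[h1 h2]] /set_mem[_ /andP[h3 h4]].
    by apply: itinerary_inj; rewrite !ltW.
  by move=> x [g h]; apply: univoque_itinerary.
have [x [x0 x1 nx]] := avoid_countable (countable_setU c1 countable_nongeneric) (@ltr01 R).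
apply: nx; have [g|] := pselect (generic x); [left|by right].
by split=> //; rewrite x1 (lt_trans _ x0).
Qed.

(** Below the Thue-Morse sequence there are only countably many univoque
    sequences. *)
Lemma thue_morse_le_kneading : (thue_morse <= kneading)%O.
Proof.
rewrite leNgt; apply/negP => lt_k.
have [|k lt_k'] := lt_seq_near (z := fun k => iter k double golden) _ lt_k.
  move=> k; apply: (agree_le (m := 2 ^ k)%N); first exact/ltnW/ltn_expl.
  exact: agree_thue_morse.
apply: uncountable_univoque_kneading.
apply: sub_countable (countable_univoque_double k); apply: subset_card_le => x.
by apply: univoque_mono negbK lt_negb _ _ _ _; apply: ltW.
Qed.

(** Points at a distance of more than [2 / b ^ n] have different itineraries up to
    time [n], for otherwise their [n]-th images would be more than [2] apart; and
    [0, 1] contains about [b ^ n / 4] such points, even generic ones. *)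
Lemma many_prefixes n N : 4 * N%:R <= b ^+ n ->
  exists c : nat -> bsq,
    (forall j, (j < N)%N -> univoque negb kneading (c j) /\ c j 0%N) /\
    (forall i j, (i < N)%N -> (j < N)%N -> agree n (c i) (c j) -> i = j).
Proof.
move=> hN; have bn : 0 < b ^+ n by rewrite exprn_gt0.
have ex j : exists x, [/\ 4 * j%:R / b ^+ n < x, x < (4 * j%:R + 1) / b ^+ n & generic x].
  have [|x [h1 h2 /contrapT h3]] :=
      avoid_countable countable_nongeneric (_ : 4 * j%:R / b ^+ n < (4 * j%:R + 1) / b ^+ n).
    by rewrite ltr_pM2r ?invr_gt0 // ltrDl.
  by exists x.
have [x hx] := choice ex.
have x_pos j : 0 < x j.
  by have [h _ _] := hx j; apply: le_lt_trans h; rewrite divr_ge0 // ?ltW // mulr_ge0.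
have x_lt1 j : (j < N)%N -> x j < 1.
  move=> jN; have [_ h _] := hx j; apply: lt_le_trans h _.
  rewrite ler_pdivrMr // mul1r; apply: le_trans hN.
  have : j.+1%:R <= N%:R :> R by rewrite ler_nat.
  by rewrite -natr1; lra.
exists (fun j => itinerary (x j)); split.
  move=> j jN; split; last by rewrite /itinerary /= ltW.
  have [_ _ g] := hx j; apply: univoque_itinerary => //.
  by rewrite x_lt1 // andbT; apply: lt_trans (x_pos j); lra.
have sep i j : (i < j)%N -> (j < N)%N -> ~ agree n (itinerary (x i)) (itinerary (x j)).
  move=> ij jN /iter_sign_map_sub E.
  have [_ h1 _] := hx i; have [h2 _ _] := hx j.
  have : i.+1%:R <= j%:R :> R by rewrite ler_nat.
  rewrite -natr1 => hij.
  rewrite ltr_pdivlMr // in h1; rewrite ltr_pdivrMr // in h2.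
  have bnd k : (k < N)%N -> -1 <= iter n sign_map (x k) <= 1.
    move=> kN; apply: iter_sign_map_bound; have := x_pos k; have := x_lt1 k kN; lra.
  have /andP[h3 h4] := bnd i (ltn_trans ij jN).
  have /andP[h5 h6] := bnd j jN.
  by lra.
move=> i j iN jN agr; case: (ltngtP i j) => // /sep h; first by case: (h jN).
by case: (h iN); apply: agree_sym.
Qed.

(** The sign words that are possible for the points of [l, r]. Both signs are
    allowed at [0]; the recursion replaces the interval by the closures of the
    images of its negative and positive parts. *)
Fixpoint branches (n : nat) (l r : R) : seq (seq bool) :=
  if n is n'.+1 then
    (if 0 <= r then map (cons true) (branches n' (b * Num.max l 0 - 1) (b * r - 1)) else [::])
    ++ (if l <= 0 then map (cons false) (branches n' (b * l + 1) (b * Num.min r 0 + 1)) else [::])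
  else [:: [::]].

(** A univoque sequence need not be the itinerary of a point, but it suffices that
    it lies between the itineraries of the end points of the interval, and this
    is inherited by the images. *)
Lemma mem_branches n l r (c : bsq) : -1 <= l -> l <= r -> r <= 1 ->
  univoque negb kneading c ->
  (refb (itinerary (- l)) <= c)%O -> (c <= itinerary r)%O ->
  mkseq c n \in branches n l r.
Proof.
elim: n l r c => [|n IH] l r c l1 lr r1 uc lc cr; first by rewrite inE.
have -> : mkseq c n.+1 = c 0%N :: mkseq (shift 1 c) n.
  by rewrite /mkseq -[n.+1]add1n iotaD map_cat /= (iotaDl 1) -map_comp.
have uc' := univoque_shift 1 uc.
have tl x : shift 1 (itinerary x) = itinerary (sign_map x) by rewrite shift_itinerary.
have tlr x : shift 1 (refb (itinerary x)) = refb (itinerary (sign_map x)).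
  by rewrite -tl.
have [lok cok] : (refb kneading <= shift 1 c)%O /\ (shift 1 c <= kneading)%O.
  by have [/ltW h1 /ltW h2] := uc 1%N.
have lr' : 0 <= r - l by rewrite subr_ge0.
have {}lr' := scale_pos lr'.
rewrite mem_cat; apply/orP; case c0 : (c 0%N); [left|right].
- have r0 : 0 <= r by have := le_head cr; rewrite c0 /itinerary /=; case: (0 <= r).
  rewrite r0 mem_map; last by move=> u v [].
  have r' := scale_pos r0.
  apply: IH => //.
  + by case: (leP l 0) => h; [lra|have := scale_pos (ltW h); lra].
  + by case: (leP l 0) => h; lra.
  + by lra.
  + case: (leP l 0) => h; first by rewrite mulr0 sub0r opprK.
    have -> : - (b * l - 1) = sign_map (- l) by rewrite sign_map_neg ?oppr_lt0 //; ring.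
    rewrite -tlr le_behead // c0 /reflect_seq /itinerary /= oppr_ge0.
    by rewrite leNgt h.
  + rewrite -sign_map_pos // -tl le_behead // c0 /itinerary /= r0 //.
- have l0 : l <= 0.
    have := le_head lc; rewrite c0 /itinerary /reflect_seq /= oppr_ge0.
    by case: (l <= 0).
  rewrite l0 mem_map; last by move=> u v [].
  have l' := scale_neg l0.
  apply: IH => //.
  + by lra.
  + by case: (leP r 0) => h; lra.
  + by case: (leP r 0) => h; [have := scale_neg h; lra|lra].
  + have -> : - (b * l + 1) = sign_map (- l) by rewrite sign_map_pos ?oppr_ge0 //; ring.
    rewrite -tlr le_behead // c0 /reflect_seq /itinerary /= oppr_ge0.
    by rewrite l0.
  + have [r0|r0] := ltP r 0.
      rewrite -sign_map_neg // -tl le_behead // c0 /itinerary /=.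
      by rewrite leNgt r0.
    by rewrite mulr0 add0r.
Qed.

Lemma mem_branches_univoque n (c : bsq) : univoque negb kneading c ->
  mkseq c n \in branches n (-1) 1.
Proof.
move=> uc; have [le11 _] := andP one_in.
apply: mem_branches => //; have [h1 h2] := uc 0%N.
  by rewrite opprK -[c]shift0 ltW.
by rewrite -[c]shift0 ltW.
Qed.

Definition branch_count n l r : nat := size (branches n l r).

Lemma branch_countS n l r : branch_count n.+1 l r =
  ((if (0 <= r)%R then branch_count n (b * Num.max l 0 - 1)%R (b * r - 1)%R else 0)
   + (if (l <= 0)%R then branch_count n (b * l + 1)%R (b * Num.min r 0 + 1)%R else 0))%N.
Proof. by rewrite /branch_count /= size_cat; congr (_ + _)%N; case: ifP; rewrite ?size_map. Qed.

Lemma branch_countN n l r : branch_count n (- r) (- l) = branch_count n l r.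
Proof.
elim: n l r => // n IH l r; rewrite !branch_countS addnC oppr_ge0 oppr_le0.
have hmax : Num.max (- r) 0 = - Num.min r 0 by rewrite oppr_min oppr0.
have hmin : Num.min (- l) 0 = - Num.max l 0 by rewrite oppr_max oppr0.
rewrite hmax hmin; congr (_ + _)%N; case: ifP => // _; rewrite -IH; congr branch_count; ring.
Qed.

Lemma branch_count_le n l r : (branch_count n l r <= 2 ^ n)%N.
Proof.
elim: n l r => // n IH l r; rewrite branch_countS expnS mul2n -addnn.
by apply: leq_add; case: ifP.
Qed.

Section Splitting.
Variables (K : nat) (delta : R).
Hypothesis delta_le : forall i, (i <= K)%N -> delta <= `|iter i sign_map 1|.

Let pow_ge1 n : 1 <= b ^+ n.
Proof. by rewrite exprn_ege1 // ltW. Qed.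

(** A short interval that ends at a point of the orbit of [1] does not meet
    [0] for a long time, because that orbit keeps away from [0]. *)
Lemma branch_count_endpoint k j l r : r = iter j sign_map 1 -> (j + k <= K)%N ->
  l <= r -> (r - l) * b ^+ k < delta -> (branch_count k l r <= 1)%N.
Proof.
elim: k j l r => // k IH j l r rE jk lr small.
have far : delta <= `|r| by rewrite rE; apply: delta_le; lia.
have small1 : r - l < delta.
  by apply: le_lt_trans small; rewrite ler_peMr // subr_ge0.
have small' : (b * (r - l)) * b ^+ k < delta by rewrite exprS in small; lra.
have jk' : (j.+1 + k <= K)%N by rewrite addSnnS.
rewrite branch_countS; have [r0|r0] := leP 0 r.
  rewrite ger0_norm // in far; have l0 : 0 < l by lra.
  rewrite [l <= 0]leNgt l0 addn0 max_l ?ltW //.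
  have rE' : b * r - 1 = iter j.+1 sign_map 1 by rewrite iterS -rE sign_map_pos.
  apply: (IH _ _ _ rE' jk'); first by rewrite lerD2r ler_pM2l.
  by have -> : b * r - 1 - (b * l - 1) = b * (r - l) by ring.
have l0 : l <= 0 by lra.
have rE' : b * r + 1 = iter j.+1 sign_map 1 by rewrite iterS -rE sign_map_neg.
rewrite l0 add0n; apply: (IH _ _ _ rE' jk'); first by rewrite lerD2r ler_pM2l.
by have -> : b * r + 1 - (b * l + 1) = b * (r - l) by ring.
Qed.

(** At the first time that a short interval meets [0], it is cut into two intervals
    that end at [1] or [-1], and these are not cut any more. *)
Lemma branch_count_short k l r : (k <= K)%N -> l <= r ->
  (r - l) * b ^+ k < delta -> (branch_count k l r <= 2)%N.
Proof.
elim: k l r => // k IH l r kK lr small; rewrite branch_countS.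
have small' : (b * (r - l)) * b ^+ k < delta by rewrite exprS in small; lra.
have {}IH l' r' : l' <= r' -> r' - l' = b * (r - l) -> (branch_count k l' r' <= 2)%N.
  by move=> h E; apply: IH => //; [lia|rewrite E].
have [r0|r0] := leP 0 r; last first.
  have l0 : l <= 0 by lra.
  rewrite l0 add0n; apply: IH; last by ring.
  by rewrite lerD2r ler_pM2l.
have [l0|l0] := leP l 0; last first.
  rewrite addn0; apply: IH; last by ring.
  by rewrite lerD2r ler_pM2l.
have bk : 0 < b ^+ k by rewrite exprn_gt0.
have lb := scale_neg l0; have rb := scale_pos r0.
have endpoint l' : l' <= 1 -> (1 - l') <= b * (r - l) -> (branch_count k l' 1 <= 1)%N.
  move=> l1 le_l; apply: (@branch_count_endpoint k 0) => //; first exact: ltnW.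
  by apply: le_lt_trans small'; rewrite ler_pM2r.
apply: (@leq_add _ _ 1 1); last by rewrite mulr0 add0r; apply: endpoint; lra.
by rewrite mulr0 sub0r -branch_countN opprK; apply: endpoint; lra.
Qed.

Hypothesis delta_gt0 : 0 < delta.

(** Long intervals are few, since the total length is only multiplied by [b] at
    each step; short ones split at most once in [K] steps. *)
Lemma branch_count_grow n l r : l <= r ->
  (branch_count (n + K) l r)%:R <=
    2 * (branch_count n l r)%:R + (2 * b) ^+ K / delta * b ^+ n * (r - l) :> R.
Proof.
set C := _ / _; have C0 : 0 < C by rewrite divr_gt0 // exprn_gt0 // mulr_gt0.
elim: n l r => [|n IH] l r lr.
  rewrite add0n expr0 mulr1 [branch_count 0 _ _]/branch_count /= mulr1.
  have [small|big] := ltP ((r - l) * b ^+ K) delta.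
    have : (branch_count K l r)%:R <= 2%:R :> R by rewrite ler_nat branch_count_short.
    move/le_trans; apply; rewrite lerDl; apply: mulr_ge0; [exact: ltW|lra].
  have : (branch_count K l r)%:R <= (2 ^ K)%:R :> R by rewrite ler_nat branch_count_le.
  move/le_trans; apply; rewrite -[leLHS]add0r lerD // natrX /C exprMn.
  rewrite mulrAC ler_pdivlMr // -[leRHS]mulrA ler_pM2l ?exprn_gt0 //.
  by rewrite mulrC.
rewrite addSn !branch_countS !natrD exprS.
have bn : 0 < b ^+ n by rewrite exprn_gt0.
have lr' : b * l <= b * r by rewrite ler_pM2l.
have [r0|r0] := leP 0 r; have [l0|l0] := leP l 0.
- have h1 := IH (b * 0 - 1) (b * r - 1); have h2 := IH (b * l + 1) (b * 0 + 1).
  have l' := scale_neg l0; have r' := scale_pos r0.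
  have {}h1 := h1 ltac:(lra); have {}h2 := h2 ltac:(lra).
  apply: le_trans (lerD h1 h2) _; rewrite le_eqVlt; apply/orP; left; apply/eqP; ring.
- have h1 := IH (b * l - 1) (b * r - 1) ltac:(lra).
  rewrite !addr0; apply: le_trans h1 _; rewrite le_eqVlt; apply/orP; left; apply/eqP; ring.
- have h1 := IH (b * l + 1) (b * r + 1) ltac:(lra).
  rewrite !add0r; apply: le_trans h1 _; rewrite le_eqVlt; apply/orP; left; apply/eqP; ring.
- by lra.
Qed.

End Splitting.

(** With [4 < b ^ K] the two branches of a short interval are outweighed by the
    factor [b ^ K], so the recursion of [branch_count_grow] can be solved. *)
Lemma branch_count_bound : generic 1 ->
  exists2 A : R, 0 < A & forall n, (branch_count n (-1) 1)%:R <= A * b ^+ n.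
Proof.
move=> g1; have [K hK] := pow_unbounded 4 b_gt1.
have [delta delta0 hdelta] : exists2 delta : R, 0 < delta &
    forall i, (i <= K)%N -> delta <= `|iter i sign_map 1|.
  elim: K {hK} => [|K [delta d0 hd]].
    by exists 1 => // i; rewrite leqn0 => /eqP -> /=; rewrite normr1.
  exists (Num.min delta `|iter K.+1 sign_map 1|).
    by rewrite lt_min d0 normr_gt0; apply: g1.
  move=> i; rewrite leq_eqVlt => /predU1P[->|iK]; first by rewrite ge_min lexx orbT.
  by rewrite ge_min hd.
pose C := (2 * b) ^+ K / delta.
have C0 : 0 < C by rewrite divr_gt0 // exprn_gt0 // mulr_gt0.
pose A := (2 ^ K)%:R + C.
have A0 : 0 < A by rewrite addr_gt0 // ltr0n expn_gt0.
exists A => //; elim/ltn_ind => n IH; have bn k : 0 < b ^+ k by rewrite exprn_gt0.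
have [nK|Kn] := ltnP n K.
  apply: (@le_trans _ _ (2 ^ K)%:R).
    by rewrite ler_nat (leq_trans (branch_count_le _ _ _)) // leq_exp2l // ltnW.
  apply: (@le_trans _ _ A); first by rewrite lerDl ltW.
  by rewrite ler_peMr ?(ltW A0) // exprn_ege1 // ltW.
have h1 : -1 <= 1 :> R by lra.
have K0 : (0 < K)%N by case: K hK {C C0 A A0 Kn hdelta IH} => //; rewrite expr0; lra.
have := branch_count_grow hdelta delta0 (n - K) h1; rewrite subnK // -/C.
have bE : b ^+ n = b ^+ (n - K) * b ^+ K by rewrite -exprD subnK.
have := IH (n - K)%N ltac:(lia); rewrite bE.
move: (branch_count (n - K) _ _) (bn (n - K)%N); move: (b ^+ (n - K)) => B x B0 hx h.
apply: le_trans h _.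
have : C <= A by rewrite lerDr.
move=> CA; have : C * B <= A * B by rewrite ler_pM2r.
have : 4 * (A * B) <= A * (B * b ^+ K).
  have -> : A * (B * b ^+ K) = b ^+ K * (A * B) by ring.
  by rewrite ler_pM2r ?mulr_gt0 // ltW.
by lra.
Qed.

End SignMap.

(** Only the repelling fixed point [1 / (b - 1)], which lies outside [-1, 1] when
    [b < 2], has the constant itinerary. *)
Lemma kneading_neq_ones (b : R) : 1 < b -> b < 2 -> kneading b != ones.
Proof.
move=> b1 b2; apply/eqP => E; pose y := (b - 1)^-1.
have b0 : 0 < b - 1 by rewrite subr_gt0.
have y1 : 1 < y by rewrite invf_gt1 //; lra.
have hy : (b - 1) * y = 1 by rewrite mulfV // gt_eqF.
have fixed_y : sign_map b y = y by rewrite sign_map_pos; lra.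
have iter_y n : iter n (sign_map b) y = y by elim: n => //= n ->.
have itin_y n : agree n (kneading b) (itinerary b y).
  by move=> i _; rewrite E /itinerary iter_y /ones; apply/esym/ltW; lra.
have [n hn] := pow_unbounded ((y + 1) / (y - 1)) b1.
have := iter_sign_map_sub (itin_y n); rewrite iter_y.
have one_in : (-1 <= 1 :> R) && (1 <= 1 :> R) by rewrite lexx andbT; lra.
have /andP[h _] := iter_sign_map_bound b1 (ltW b2) n one_in.
by rewrite ltr_pdivrMr in hn; lra.
Qed.

(** For each prescribed list of signs the bases where the orbit of [1] reaches [0]
    are roots of a monic polynomial, hence countably many in all. *)
Lemma generic_one_dense (u v : R) : u < v ->
  exists b, [/\ u < b, b < v & generic b 1].
Proof.
move=> uv.
(* with the signs [w] prescribed, the [n]-th image of [1] is a monic polynomial in [b] *)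
pose P := fix P (w : nat -> bool) n : {poly R} :=
  if n is n'.+1 then 'X * P w n' - (if w n' then 1 else -1) else 1.
have szP w n : size (P w n) = n.+1.
  elim: n => [|n IH] /=; first by rewrite size_poly1.
  have E : size ('X * P w n) = n.+2.
    by rewrite mulrC size_mulX ?IH // -size_poly_gt0 IH.
  rewrite size_polyDl ?E // size_polyN; case: (w n); rewrite ?size_polyN size_poly1 //.
have PE b n : (P (itinerary b 1) n).[b] = iter n (sign_map b) 1.
  elim: n => [|n IH] /=; first by rewrite hornerC.
  rewrite hornerD hornerN hornerM hornerX IH /sign_map /itinerary.
  by case: ifP => _; rewrite ?hornerN hornerC.
have PE' w w' n : agree n (w : bsq) w' -> P w n = P w' n.
  elim: n => //= n IH aw; rewrite IH; last by apply: agree_le aw.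
  by rewrite aw.
pose W := fun nw : nat * seq bool => [set b | root (P (nth false nw.2) nw.1) b].
have cW : countable (\bigcup_(nw in setT) W nw).
  apply: bigcup_countable => // -[n w] _; apply: countable_roots.
  by rewrite -size_poly_gt0 szP.
have [b [h1 h2 nb]] := avoid_countable cW uv.
exists b; split=> // n; apply/eqP => E; apply: nb.
exists (n, mkseq (itinerary b 1) n) => //; rewrite /W /= /root.
rewrite (@PE' _ (itinerary b 1)) ?PE ?E // => i lti.
by rewrite nth_mkseq.
Qed.

End Expansion.

(** * Quasi-greedy expansions *)

Section QuasiGreedy.
Context {R : realType} {M : nat}.
Implicit Types (p q x : R) (s t : Omega M).

(** [remainder q x s n] is [q ^ n (x - \sum_(i < n) s_i / q ^ i.+1)], the point
    reached from [x] after subtracting the first [n] digits of [s]. *)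
Fixpoint remainder q x s n : R :=
  if n is n'.+1 then q * remainder q x s n' - (s n' : nat)%:R else x.

(** An expansion of [1] is quasi-greedy iff its remainders stay in [0, 1]
    without ever reaching [0]. *)
Definition greedy_remainders q s : Prop := forall n, 0 < remainder q 1 s n <= 1.

Lemma remainderD q x s m n :
  remainder q x s (m + n) = remainder q (remainder q x s m) (shift m s) n.
Proof. by elim: n => [|n IH]; rewrite ?addn0 // addnS /= IH. Qed.

Lemma remainder_sub q x y s n :
  remainder q y s n - remainder q x s n = q ^+ n * (y - x).
Proof.
elim: n => [|n IH] /=; first by rewrite expr0 mul1r.
by rewrite exprS -mulrA -IH; ring.
Qed.

Lemma remainder_agree q x s t n : agree n s t -> remainder q x s n = remainder q x t n.
Proof.
elim: n => //= n IH ast; rewrite IH; last by apply: agree_le ast.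
by rewrite ast.
Qed.

Lemma remainder_le q x y s n : 0 < q -> x <= y -> remainder q x s n <= remainder q y s n.
Proof.
by move=> q0 xy; rewrite -subr_ge0 remainder_sub mulr_ge0 ?exprn_ge0 ?subr_ge0 // ltW.
Qed.

Lemma series_remainder q s n : q != 0 ->
  series (fun i => (s i : nat)%:R / q ^+ i.+1) n = 1 - remainder q 1 s n / q ^+ n.
Proof.
move=> q0; elim: n => [|n IH].
  by rewrite /series /= big_geq // expr0 divr1 subrr.
rewrite seriesSr IH /= exprS; field.
by rewrite q0 expf_neq0.
Qed.

Section Fixed.
Variable q : R.
Hypothesis q_gt1 : 1 < q.
Let q_gt0 : 0 < q := lt_trans ltr01 q_gt1.
Let q_neq0 : q != 0. Proof. by rewrite gt_eqF. Qed.

Lemma remainder_le0 x s n : x <= 0 -> remainder q x s n <= 0.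
Proof.
move=> x0; elim: n => //= n IH; rewrite subr_le0.
by apply: (@le_trans _ _ 0) => //; rewrite pmulr_rle0.
Qed.

Lemma expansion_remainder_ge0 s n : is_expansion q 1 s -> 0 <= remainder q 1 s n.
Proof.
rewrite /is_expansion => es; set u := (fun i => _) in es.
have incr : nondecreasing_seq (series u).
  apply: nondecreasing_series => i _ _; rewrite divr_ge0 // exprn_ge0 // ltW //.
have := nondecreasing_cvgn_le incr (cvgP _ es) n.
rewrite (cvg_lim _ es) // series_remainder // gerBl pmulr_lge0 //.
by rewrite invr_gt0 exprn_gt0.
Qed.

Lemma remainder_not_zeros s : (forall n, 0 <= remainder q 1 s n) ->
  ~ ends_with_zeros s -> forall n, 0 < remainder q 1 s n.
Proof.
move=> ge0 nz n; rewrite lt_def ge0 andbT; apply/eqP => E0.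
apply: nz; exists n.
have zero k : remainder q 1 s (n + k) = 0.
  elim: k => [|k IH]; first by rewrite addn0.
  apply/eqP; rewrite eq_le ge0 andbT addnS /= IH mulr0 sub0r oppr_le0 //.
move=> k nk; have := ge0 k.+1; rewrite /= -{1}(subnKC nk) zero mulr0 sub0r oppr_ge0.
rewrite (_ : 0 = 0%:R) // ler_nat leqn0 => /eqP E.
exact: val_inj.
Qed.

Lemma greedy_expansion s : greedy_remainders q s -> is_expansion q 1 s.
Proof.
move=> gs; rewrite /is_expansion.
rewrite (_ : series _ = fun n => 1 - remainder q 1 s n / q ^+ n); last first.
  by apply: funext => n; apply: series_remainder.
rewrite -[X in _ --> X]subr0; apply: cvgB; first exact: cvg_cst.
have geo : (fun n => q^-1 ^+ n) @ \oo --> (0 : R).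
  by apply: cvg_expr; rewrite ger0_norm ?invf_lt1 // invr_ge0 ltW.
apply: (squeeze_cvgr _ (cvg_cst (0 : R)) geo); apply: nearW => n.
have /andP[h1 h2] := gs n; have qn : 0 < q ^+ n by rewrite exprn_gt0.
apply/andP; split; first exact: divr_ge0 (ltW h1) (ltW qn).
by rewrite exprVn ler_pdivrMr // mulVf // gt_eqF.
Qed.

Lemma greedy_not_zeros s : greedy_remainders q s -> ~ ends_with_zeros s.
Proof.
move=> gs [N hN]; have /andP[x0 _] := gs N.
have E k : remainder q 1 s (N + k) = q ^+ k * remainder q 1 s N.
  elim: k => [|k IH]; first by rewrite addn0 mul1r.
  by rewrite addnS /= IH hN ?leq_addr // subr0 exprS mulrA.
have [k hk] := pow_unbounded (remainder q 1 s N)^-1 q_gt1.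
have /andP[_] := gs (N + k)%N; rewrite E leNgt => /negP; apply.
by rewrite -ltr_pdivrMr // mul1r.
Qed.

Lemma greedy_is_quasi_greedy s : greedy_remainders q s -> is_quasi_greedy q s.
Proof.
move=> gs; split; [exact: greedy_expansion|exact: greedy_not_zeros|].
move=> t et nzt; rewrite leNgt; apply/negP => /seq_ltP[n [ast lt_n]].
have := remainder_not_zeros (fun k => expansion_remainder_ge0 k et) nzt n.+1.
rewrite /= -(remainder_agree _ _ ast) => h.
have /andP[_ h1] := gs n.+1; rewrite /= in h1.
have : (s n).+1%:R <= (t n : nat)%:R :> R by rewrite ler_nat.
rewrite -natr1; lra.
Qed.

Lemma greedy_alpha s : greedy_remainders q s -> alpha M q = s.
Proof.
move=> /greedy_is_quasi_greedy gs; rewrite /alpha; case: xgetP => [t _ gt|/(_ s)//].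
case: gs gt => e1 z1 m1 [e2 z2 m2].
by apply/eqP; rewrite eq_le m1 ?m2.
Qed.

Lemma greedy_exists : q <= M.+1%:R -> exists s, greedy_remainders q s.
Proof.
move=> qM.
have ex x : exists d : 'I_M.+1, 0 < x <= 1 -> 0 < q * x - (d : nat)%:R <= 1.
  have [/andP[x0 x1]|_] := boolP (0 < x <= 1); last by exists ord0.
  have P0 : ((ord0 : 'I_M.+1) : nat)%:R < q * x by rewrite mulr_gt0.
  case: (@arg_maxnP 'I_M.+1 ord0 (fun i : 'I_M.+1 => (i : nat)%:R < q * x) (fun i => i : nat) P0).
  move=> d dx maxd; exists d => _; rewrite subr_gt0 dx /= lerBlDr addrC natr1.
  have [dM|dM] := ltnP d M.
    rewrite leNgt; apply/negP => h.
    have hd : (d.+1 < M.+1)%N by [].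
    by have := maxd (Ordinal hd) h; rewrite /= /geq /= ltnn.
  have -> : (d : nat) = M by apply/eqP; rewrite eqn_leq dM -ltnS ltn_ord.
  apply: le_trans qM; rewrite ler_piMr // ltW //.
have [f hf] := choice ex.
pose x := fix x n := if n is n'.+1 then q * x n' - (f (x n') : nat)%:R else 1.
have xP n : 0 < x n <= 1 by elim: n => [|n /hf //]; rewrite /= ltr01 lexx.
exists (fun n => f (x n)) => n.
have -> : remainder q 1 (fun n => f (x n)) n = x n by elim: n => //= n ->.
exact: xP.
Qed.

Lemma alpha_greedy : q <= M.+1%:R -> greedy_remainders q (alpha M q).
Proof. by move=> /greedy_exists[s gs]; rewrite (greedy_alpha gs). Qed.

(** When the sequence drops below [alpha(q)], its remainder exceeds [1] and the
    comparison starts afresh with a shift of the sequence, which is again below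
    [alpha(q)]. *)
Lemma remainder_gt0_of_le s t : greedy_remainders q t -> (s <= t)%O ->
  (forall n, shift n s <= s)%O -> forall n, 0 < remainder q 1 s n.
Proof.
move=> gt st ss n.
suff h k x : 1 <= x -> 0 < remainder q x (shift k s) n.
  by rewrite -[s]shift0; apply: h.
elim/ltn_ind: n k x => n IH k x x1.
have le_t : (shift k s <= t)%O by apply: le_trans st.
have [akt|] := pselect (agree n (shift k s) t).
  rewrite (remainder_agree _ _ akt); have /andP[h _] := gt n.
  exact: lt_le_trans h (remainder_le _ _ q_gt0 x1).
move=> /existsNP[i0 nak].
move: le_t; rewrite le_eqVlt => /predU1P[E|/seq_ltP[j [aj lt_j]]].
  by case: nak => _; rewrite E.
have jn : (j < n)%N.
  rewrite ltnNge; apply/negP => nj; apply: nak => i0n; apply: aj; exact: leq_trans nj.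
rewrite -(subnKC jn) remainderD shiftD; apply: IH; first by lia.
rewrite /= (remainder_agree _ _ aj).
have /andP[h _] := gt j.+1; rewrite /= in h.
have : q * remainder q 1 t j <= q * remainder q x t j.
  by rewrite ler_pM2l // remainder_le.
have : (shift k s j).+1%:R <= (t j : nat)%:R :> R by rewrite ler_nat.
rewrite -natr1; lra.
Qed.

(** When the sequence exceeds [alpha(q)], its remainder drops to [0] or below, and
    remains there. *)
Lemma remainder_le1_of_ge s t : greedy_remainders q t -> (t <= s)%O ->
  forall n, remainder q 1 s n <= 1.
Proof.
move=> gt + n; rewrite le_eqVlt => /predU1P[<-|/seq_ltP[j [aj lt_j]]].
  by have /andP[] := gt n.
have [nj|jn] := leqP n j.
  by rewrite -(remainder_agree _ _ (agree_le nj aj)); have /andP[] := gt n.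
apply: le_trans ler01; rewrite -(subnKC jn) remainderD; apply: remainder_le0.
rewrite /= -(remainder_agree _ _ aj); have /andP[_] := gt j.+1; rewrite /=.
have : (t j).+1%:R <= (s j : nat)%:R :> R by rewrite ler_nat.
rewrite -natr1; lra.
Qed.

(** If [alpha(q)] has period [m] then so have the remainders. Hence the [m]-th one is
    [1], while a positive first digit makes it at most [q ^ m - q ^ m.-1]. *)
Lemma periodic_pow_ge2 s m : greedy_remainders q s -> (0 < m)%N -> shift m s = s ->
  (0 < s 0%N)%N -> 2 <= q ^+ m.
Proof.
move=> gs m0 per s0; set y := remainder q 1 s m.
have rem_per n : remainder q y s n = remainder q 1 s (m + n).
  by rewrite remainderD per.
have y1 : y = 1.
  apply/eqP; rewrite eq_le; have /andP[_ ->] := gs m; rewrite leNgt; apply/negP => lt_y.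
  have [n hn] := pow_unbounded (1 - y)^-1 q_gt1.
  have := remainder_sub q y 1 s n; rewrite rem_per.
  have /andP[_ h1] := gs n; have /andP[h2 _] := gs (m + n)%N.
  have : 1 < q ^+ n * (1 - y) by rewrite -ltr_pdivrMr ?subr_gt0 // mul1r.
  by lra.
have up n : remainder q 1 s n.+1 <= q ^+ n * (q - 1).
  elim: n => [|n IH].
    by rewrite /= mulr1 expr0 mul1r lerB // ler1n.
  rewrite -[leLHS]/(q * remainder q 1 s n.+1 - (s n.+1 : nat)%:R) exprS -mulrA.
  apply: (@le_trans _ _ (q * remainder q 1 s n.+1)).
    by rewrite gerBl.
  by rewrite ler_pM2l.
have := up m.-1; rewrite prednK // -/y y1 => h.
have : 1 <= q ^+ m.-1 by rewrite exprn_ege1 // ltW.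
have -> : q ^+ m = q ^+ m.-1 * q by rewrite -exprSr prednK.
lra.
Qed.

End Fixed.

(** The digits cancel in the difference of the remainders, which is therefore
    multiplied by at least [p] at each step. *)
Lemma remainder_base_gap p q s t n : 0 < p -> p <= q -> greedy_remainders p s ->
  agree n.+1 s t ->
  p ^+ n * (q - p) <= remainder q 1 t n.+1 - remainder p 1 s n.+1.
Proof.
move=> p0 pq gs; elim: n => [|n IH] ast.
  by rewrite expr0 mul1r /= !mulr1 ast //; lra.
have {}IH := IH (agree_le (leqnSn _) ast).
rewrite -[remainder q 1 t n.+2]/(q * remainder q 1 t n.+1 - (t n.+1 : nat)%:R).
rewrite -[remainder p 1 s n.+2]/(p * remainder p 1 s n.+1 - (s n.+1 : nat)%:R).
rewrite (ast n.+1) // exprS.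
have /andP[h _] := gs n.+1.
have pn : 0 <= p ^+ n * (q - p) by rewrite mulr_ge0 ?subr_ge0 // exprn_ge0 // ltW.
have h1 : 0 <= remainder q 1 t n.+1 by lra.
have h2 : 0 <= (q - p) * remainder q 1 t n.+1 by rewrite mulr_ge0 // subr_ge0.
have h3 : p * (p ^+ n * (q - p)) <= p * (remainder q 1 t n.+1 - remainder p 1 s n.+1).
  by rewrite ler_pM2l.
by lra.
Qed.

Lemma greedy_lt p q s t : 1 < p -> p < q -> greedy_remainders p s ->
  greedy_remainders q t -> (s < t)%O.
Proof.
move=> p1 pq gs gt; have p0 : 0 < p by apply: lt_trans p1.
rewrite ltNge le_eqVlt; apply/negP => /predU1P[E|/seq_ltP[n [ats lt_n]]].
  have [n hn] := pow_unbounded (q - p)^-1 p1.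
  have := @remainder_base_gap p q s t n p0 (ltW pq) gs; rewrite E => /(_ (fun _ _ => erefl)).
  have /andP[_ h1] := gt n.+1; have /andP[h2 _] := gs n.+1.
  have : 1 < p ^+ n * (q - p) by rewrite -ltr_pdivrMr ?subr_gt0 // mul1r.
  by rewrite E in h1 *; lra.
have ast := agree_sym ats.
have le_n : p * remainder p 1 s n <= q * remainder q 1 t n.
  have /andP[h _] := gs n.
  have h1 : remainder p 1 s n <= remainder q 1 t n.
    case: n ast {h ats lt_n} => [|n] ast; first by [].
    rewrite -subr_ge0; apply: le_trans (remainder_base_gap p0 (ltW pq) gs ast).
    by rewrite mulr_ge0 ?subr_ge0 ?exprn_ge0 // ltW.
  apply: (@le_trans _ _ (p * remainder q 1 t n)); first by rewrite ler_pM2l.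
  by rewrite ler_wpM2r ?(ltW pq) //; apply: le_trans h1; apply: ltW.
have /andP[h _] := gs n.+1; have /andP[_ h2] := gt n.+1; rewrite /= in h h2.
have : (t n).+1%:R <= (s n : nat)%:R :> R by rewrite ler_nat.
rewrite -natr1; lra.
Qed.

Lemma alpha_lt p q : 1 < p -> p < q -> q <= M.+1%:R -> (alpha M p < alpha M q)%O.
Proof.
move=> p1 pq qM; apply: (greedy_lt p1 pq); apply: alpha_greedy => //.
- by apply: le_trans qM; apply: ltW.
- exact: lt_trans pq.
Qed.

Lemma alpha_le p q : 1 < p -> p <= q -> q <= M.+1%:R -> (alpha M p <= alpha M q)%O.
Proof.
move=> p1; rewrite le_eqVlt => /predU1P[-> _|pq qM]; first exact: lexx.
exact/ltW/alpha_lt.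
Qed.

Lemma alpha_lt_inv p q : 1 < q -> p <= M.+1%:R -> (alpha M p < alpha M q)%O -> p < q.
Proof.
move=> q1 pM lt_a; rewrite ltNge; apply/negP => qp.
by have := alpha_le q1 qp pM; rewrite leNgt lt_a.
Qed.

Lemma continuous_remainder s n : continuous (fun q => remainder q 1 s n).
Proof.
elim: n => [|n IH] q /=; first exact: cvg_cst.
by apply: cvgB; [apply: cvgM; [exact: cvg_id|exact: IH]|exact: cvg_cst].
Qed.

(** The base is the supremum [r] of those with [alpha <= s]. Bases below [r] bound
    the remainders of [s] by [1], bases above [r] keep them positive, and by
    continuity [r] inherits both properties. *)
Lemma alpha_surjective p q s : 1 < p -> p <= q -> q <= M.+1%:R ->
  (alpha M p <= s)%O -> (s <= alpha M q)%O ->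
  (forall n, shift n s <= s)%O -> ~ ends_with_zeros s ->
  exists2 r, p <= r <= q & alpha M r = s.
Proof.
move=> p1 pq qM ps sq ss nz.
pose E := [set r | p <= r <= q /\ (alpha M r <= s)%O].
have Ep : E p by split=> //; rewrite lexx pq.
have Eub : ubound E q by move=> r [/andP[_ rq] _].
have hsE : has_sup E by split; [exists p|exists q].
pose r := sup E.
have pr : p <= r by apply: ub_le_sup => //; exists q.
have rq : r <= q by apply: ge_sup => //; exists p.
have r1 : 1 < r by apply: lt_le_trans pr.
exists r; first by rewrite pr rq.
apply: greedy_alpha => //.
have cts n : (fun x => remainder x 1 s n) @ r --> remainder r 1 s n.
  exact: continuous_remainder.
have le1 n : remainder r 1 s n <= 1.
  rewrite leNgt; apply/negP => gt1.
  have /nbhs_ballP[e /= e0 he] : \forall x \near r, 1 < remainder x 1 s n.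
    exact: (cvgr_gt _ (cts n) _ gt1).
  have [x [/andP[px xq] xs] xr] := sup_adherent e0 hsE.
  have xler : x <= r by apply: ub_le_sup; [exists q|split; rewrite ?px].
  have : ball r e x by rewrite /ball /= ger0_norm ?subr_ge0 //; rewrite -/r in xr; lra.
  move/he; rewrite ltNge => /negP; apply.
  have x1 : 1 < x by apply: lt_le_trans px.
  apply: (remainder_le1_of_ge x1 _ xs); apply: alpha_greedy => //.
  exact: le_trans qM.
have ge0 n : 0 <= remainder r 1 s n.
  have [rqE|rq'] := eqVneq r q.
    apply/ltW; rewrite rqE; apply: (@remainder_gt0_of_le q _ s (alpha M q)) => //.
      by rewrite -rqE.
    by apply: alpha_greedy => //; rewrite -rqE.
  have {}rq : r < q by rewrite lt_neqAle rq'.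
  rewrite leNgt; apply/negP => lt0.
  have /nbhs_ballP[e /= e0 he] : \forall x \near r, remainder x 1 s n < 0.
    exact: (cvgr_lt _ (cts n) _ lt0).
  pose x := Num.min q (r + e / 2).
  have rx : r < x by rewrite lt_min rq /= ltrDl divr_gt0.
  have xq : x <= q by rewrite ge_min lexx.
  have xe : x <= r + e / 2 by rewrite ge_min lexx orbT.
  have : ball r e x by rewrite /ball /= ler0_norm ?subr_le0 ?(ltW rx) //; lra.
  move/he; rewrite ltNge => /negP; apply.
  have x1 : 1 < x by apply: lt_trans rx.
  apply/ltW; apply: (@remainder_gt0_of_le x _ s (alpha M x)) => //.
    by apply: alpha_greedy => //; apply: le_trans qM.
  rewrite leNgt; apply/negP => /ltW xs.
  have : x <= r.
    apply: ub_le_sup; first by exists q.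
    by split=> //; rewrite xq andbT (le_trans pr) // ltW.
  by rewrite leNgt rx.
by move=> n; rewrite le1 andbT; apply: remainder_not_zeros.
Qed.

End QuasiGreedy.

(** * Entropy of sets of coded sequences *)

Section Entropy.
Context {R : realType} {M : nat}.
Implicit Types X Y : set (Omega M).
Local Notation bsq := bitseq_order.

Section LimInf.
Implicit Types u v : R^o^nat.

Lemma limn_inf_ge u c N : bounded_fun u -> (forall n, (N <= n)%N -> c <= u n) ->
  c <= limn_inf u.
Proof.
move=> bu h; rewrite limn_infE //.
apply: (@le_trans _ _ (infs u N)); last first.
  by apply: ub_le_sup; [exact: bounded_fun_has_ubound_infs|exists N].
by apply: lb_le_inf; [exists (u N), N => /=|move=> _ [n /= Nn <-]; apply: h].
Qed.

Lemma infs_le u n k : bounded_fun u -> (n <= k)%N -> infs u n <= u k.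
Proof.
move=> bu nk; apply: ge_inf; last by exists k.
exact/has_lbound_sdrop/bounded_fun_has_lbound.
Qed.

Lemma limn_inf_le u c : bounded_fun u -> (forall N, exists2 n, (N <= n)%N & u n <= c) ->
  limn_inf u <= c.
Proof.
move=> bu h; rewrite limn_infE //; apply: ge_sup; first by exists (infs u 0%N), 0%N.
move=> _ [N _ <-]; have [n Nn le_n] := h N.
exact: le_trans (infs_le bu Nn) le_n.
Qed.

Lemma limn_inf_mono u v : bounded_fun u -> bounded_fun v -> (forall n, u n <= v n) ->
  limn_inf u <= limn_inf v.
Proof.
move=> bu bv uv; rewrite [leLHS]limn_infE //; apply: ge_sup; first by exists (infs u 0%N), 0%N.
move=> _ [N _ <-]; apply: (@limn_inf_ge _ _ N) => // n Nn.
exact: le_trans (infs_le bu Nn) (uv n).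
Qed.

End LimInf.

Lemma small_quotient (K e : R) : 0 < e -> exists N, forall n, (N <= n)%N ->
  [/\ (0 < n)%N, K / n%:R <= e & - e <= K / n%:R].
Proof.
move=> e0; exists (Num.truncn (`|K| / e)).+1 => n Nn.
have n0 : (0 < n)%N by apply: leq_trans Nn.
have nR : 0 < n%:R :> R by rewrite ltr0n.
have : `|K| / e < n%:R.
  by apply: lt_le_trans (truncnS_gt _) _; rewrite ler_nat.
rewrite ltr_pdivrMr // mulrC => /ltW h.
suff : `|K / n%:R| <= e by rewrite ler_norml => /andP[].
by rewrite normrM normfV (ger0_norm (ltW nR)) ler_pdivrMr.
Qed.

Definition word_count X n : nat := #|language X n|.

Lemma in_language X n (w : n.-tuple 'I_M.+1) : w \in language X n <->
  exists x, X x /\ exists k, forall i : 'I_n, x (k + i)%N = tnth w i.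
Proof. by rewrite inE; split=> [/asboolP|h]; [|apply/asboolP]. Qed.

Lemma word_count_mono X Y n : X `<=` Y -> (word_count X n <= word_count Y n)%N.
Proof.
move=> XY; apply/subset_leq_card/fintype.subsetP => w /in_language[x [Xx h]].
by apply/in_language; exists x; split=> //; apply: XY.
Qed.

Lemma word_count_gt0 X n : X !=set0 -> (0 < word_count X n)%N.
Proof.
move=> [x Xx]; apply/card_gt0P; exists [tuple x (i : nat) | i < n].
by apply/in_language; exists x; split=> //; exists 0%N => i; rewrite tnth_mktuple.
Qed.

Definition growth X : R^o^nat := fun n => n%:R^-1 * ln ((word_count X n)%:R : R).

Lemma growth_ge0 X n : X !=set0 -> 0 <= growth X n.
Proof.
by move=> X0; rewrite mulr_ge0 ?invr_ge0 // ln_ge0 // ler1n word_count_gt0.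
Qed.

Lemma growth_bounded X : X !=set0 -> bounded_fun (growth X).
Proof.
move=> X0; pose B := ln (M.+1%:R : R).
have B0 : 0 <= B by rewrite ln_ge0 // ler1n.
exists B; split; first exact: num_real.
move=> y By n _ /=; apply: le_trans (ltW By); rewrite ger0_norm ?growth_ge0 //.
rewrite /growth; have [->|n0] := posnP n; first by rewrite invr0 mul0r.
rewrite mulrC ler_pdivrMr ?ltr0n // mulr_natr -lnXn ?ltr0n //.
rewrite ler_ln ?posrE ?exprn_gt0 ?ltr0n ?word_count_gt0 // -natrX ler_nat.
by rewrite (leq_trans (max_card _)) // card_tuple card_ord.
Qed.

Lemma entropyE X : X !=set0 -> entropy R X = limn_inf (growth X).
Proof.
by move=> /set0P/eqP nX; rewrite /entropy; case: asboolP.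
Qed.

Lemma entropy_ge0 X : 0 <= entropy R X.
Proof.
have [->|/set0P X0] := eqVneq X set0; first by rewrite /entropy; case: asboolP.
rewrite entropyE //; apply: (@limn_inf_ge _ _ 0%N); first exact: growth_bounded.
by move=> n _; apply: growth_ge0.
Qed.

Lemma entropy_mono X Y : X `<=` Y -> entropy R X <= entropy R Y.
Proof.
move=> XY; have [->|/set0P X0] := eqVneq X set0.
  by rewrite {1}/entropy; case: asboolP => // _; apply: entropy_ge0.
have Y0 : Y !=set0 by case: X0 => x /XY; exists x.
rewrite !entropyE //; apply: limn_inf_mono; try exact: growth_bounded.
move=> n; rewrite /growth ler_wpM2l ?invr_ge0 //.
by rewrite ler_ln ?posrE ?ltr0n ?word_count_gt0 // ler_nat word_count_mono.
Qed.

Lemma entropy_le X m (b C : R) : (0 < m)%N -> 1 <= b -> 0 < C ->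
  (forall n, (word_count X n)%:R <= C * b ^+ (n %/ m)) -> entropy R X <= ln b / m%:R.
Proof.
move=> m0 b1 C0 h; have lb : 0 <= ln b by apply: ln_ge0.
have mR : 0 < m%:R :> R by rewrite ltr0n.
have [->|/set0P X0] := eqVneq X set0.
  by rewrite /entropy; case: asboolP => // _; rewrite divr_ge0.
rewrite entropyE //; apply/ler_addgt0Pr => e e0.
have [N hN] := small_quotient (ln C) e0.
apply: limn_inf_le; first exact: growth_bounded.
move=> N'; exists (maxn N N'); first exact: leq_maxr.
set n := maxn _ _; have [n0 h1 _] := hN n (leq_maxl _ _).
have nR : 0 < n%:R :> R by rewrite ltr0n.
have b0 : 0 < b by apply: lt_le_trans b1.
apply: (@le_trans _ _ (n%:R^-1 * (ln C + n%:R * (ln b / m%:R)))); last first.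
  rewrite mulrDr mulKf ?gt_eqF // addrC lerD2l mulrC //.
rewrite /growth ler_pM2l ?invr_gt0 //.
apply: (@le_trans _ _ (ln (C * b ^+ (n %/ m)))).
  by rewrite ler_ln ?posrE ?mulr_gt0 ?exprn_gt0 ?ltr0n ?word_count_gt0.
rewrite lnM ?posrE ?exprn_gt0 // lerD2l lnXn // -[leLHS]mulr_natl mulrA.
rewrite [leRHS]mulrAC ler_wpM2r // ler_pdivlMr // -natrM ler_nat leq_divM //.
Qed.

Lemma entropy_ge X m (b C : R) N0 : (0 < m)%N -> 1 <= b -> 0 < C ->
  (forall n, (N0 <= n)%N -> C * b ^+ (n %/ m) <= (word_count X n)%:R) ->
  ln b / m%:R <= entropy R X.
Proof.
move=> m0 b1 C0 h; have lb : 0 <= ln b by apply: ln_ge0.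
have mR : 0 < m%:R :> R by rewrite ltr0n.
have b0 : 0 < b by apply: lt_le_trans b1.
have cb n : 0 < C * b ^+ (n %/ m) by rewrite mulr_gt0 // exprn_gt0.
have X0 : X !=set0.
  apply/set0P/eqP => X0; have := h N0 (leqnn _).
  rewrite (_ : word_count X N0 = 0%N) ?leNgt ?cb //.
  apply: eq_card0 => w; apply/negP => /in_language[x []].
  by rewrite X0.
rewrite entropyE //; apply/ler_addgt0Pr => e e0; rewrite -lerBlDr.
have [N hN] := small_quotient (ln C - ln b) e0.
apply: (@limn_inf_ge _ _ (maxn N N0)); first exact: growth_bounded.
move=> n; rewrite geq_max => /andP[Nn N0n].
have [n0 _ h1] := hN n Nn; have nR : 0 < n%:R :> R by rewrite ltr0n.
apply: (@le_trans _ _ (n%:R^-1 * (ln C - ln b + n%:R * (ln b / m%:R)))).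
  by rewrite mulrDr mulKf ?gt_eqF // addrC lerD2r mulrC.
rewrite /growth ler_pM2l ?invr_gt0 //.
apply: (@le_trans _ _ (ln (C * b ^+ (n %/ m)))); last first.
  by rewrite ler_ln ?posrE ?ltr0n ?word_count_gt0 // h.
rewrite lnM ?posrE ?exprn_gt0 // lnXn // -addrA lerD2l -[ln b *+ _]mulr_natl.
rewrite mulrA [_ / _]mulrAC addrC lerBlDr -[X in _ <= _ + X]mul1r -mulrDl.
rewrite ler_wpM2r // ler_pdivrMr // natr1 -natrM ler_nat.
by rewrite ltnW // ltn_ceil.
Qed.

Lemma word_count_ge X n N (x : nat -> Omega M) : (forall j, (j < N)%N -> X (x j)) ->
  (forall i j, (i < N)%N -> (j < N)%N -> agree n (x i) (x j) -> i = j) ->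
  (N <= word_count X n)%N.
Proof.
move=> Xx inj_x; rewrite -[N]card_ord.
pose f (j : 'I_N) := [tuple x j (i : nat) | i < n].
have fi : injective f.
  move=> i j E; apply: val_inj; apply: (inj_x _ _ (ltn_ord i) (ltn_ord j)) => k kn.
  by have := congr1 (fun t => tnth t (Ordinal kn)) E; rewrite !tnth_mktuple.
rewrite -(card_imset _ fi); apply/subset_leq_card/fintype.subsetP => _ /imsetP[j _ ->].
apply/in_language; exists (x j); split; first exact: Xx.
by exists 0%N => i; rewrite tnth_mktuple.
Qed.

(** The constant [m] says how many digits of [G c] are needed for one bit of [c]. *)
Lemma entropy_ge_kneading X m (b : R) (G : bsq -> Omega M) :
  (0 < m)%N -> 1 < b -> b <= 2 ->
  (forall c, univoque negb (kneading b) c -> c 0%N -> X (G c)) ->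
  (forall n c c', agree n (G c) (G c') -> agree (n %/ m) c c') ->
  ln b / m%:R <= entropy R X.
Proof.
move=> m0 b1 b2 XG Gi; have [K hK] := pow_unbounded 4 b1.
have b0 : 0 < b by apply: lt_trans b1.
(* as soon as [4 < y], the integer part of [y / 4] is at least [y / 8] *)
apply: (@entropy_ge _ _ _ 8^-1 (K * m)) => //; first exact: ltW.
move=> n Kn; set y := b ^+ (n %/ m).
have y4 : 4 < y.
  apply: lt_le_trans hK _; rewrite ler_eXn2l //.
  by rewrite leq_divRL.
pose N := Num.truncn (y / 4).
have hN : 4 * N%:R <= y.
  by rewrite mulrC -ler_pdivlMr // truncn_le // divr_ge0 // ltW // (lt_trans _ y4).
have [c [h1 h2]] := many_prefixes b1 b2 hN.
apply: (@le_trans _ _ N%:R); last first.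
  rewrite ler_nat; apply: (@word_count_ge _ _ _ (fun j => G (c j))).
    by move=> j /h1[]; apply: XG.
  by move=> i j iN jN /Gi; apply: h2.
have : y / 4 < N.+1%:R by apply: truncnS_gt.
have : 1%:R <= N%:R :> R.
  by rewrite ler_nat truncn_gt0 ler_pdivlMr // mul1r ltW.
rewrite -natr1; lra.
Qed.

Section Substitution.
Variables (rev : 'I_M.+1 -> 'I_M.+1) (m : nat) (a ap : Omega M).
Hypothesis A : renormalizing_block rev m a ap.
Let m0 : (0 < m)%N := rb_size A.

(** A word of length [n] lies in [n %/ m + 2] consecutive blocks; it is determined by
    their code, the bit before it, and the place where the word begins. *)
Lemma word_count_subst X (D : set bsq) n (s : seq (seq bool)) :
  (forall x, X x -> exists2 c, D c & x = subst rev m a ap false c) ->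
  (forall c k, D c -> mkseq (shift k c) (n %/ m + 2) \in s) ->
  (word_count X n <= m * 2 * size s)%N.
Proof.
move=> XD Ds.
pose F (ip : nat * bool) w : n.-tuple 'I_M.+1 :=
  [tuple subst rev m a ap ip.2 (nth false w) (ip.1 + j)%N | j < n].
pose L := [seq F ip w | ip <- [seq (i, p) | i <- iota 0 m, p <- [:: true; false]], w <- s].
have -> : (m * 2 * size s = size L)%N by rewrite !size_allpairs size_iota.
rewrite /word_count cardE; apply: uniq_leq_size; first exact: enum_uniq.
move=> w; rewrite mem_enum => /in_language[x [/XD[c Dc ->] [k hk]]].
have -> : w = F (k %% m, previous false c (k %/ m))%N (mkseq (shift (k %/ m) c) (n %/ m + 2)).
  apply: eq_from_tnth => j; rewrite -hk tnth_mktuple /=.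
  rewrite {1}(divn_eq k m) -addnA -/(shift _ _ _) (shift_subst A).
  have agr : agree (n %/ m + 2) (shift (k %/ m) c)
      (nth false (mkseq (shift (k %/ m) c) (n %/ m + 2))).
    by move=> i lti; rewrite nth_mkseq.
  apply: (agree_subst A _ agr).
  have := ltn_pmod k m0; have := ltn_ceil n m0; have := ltn_ord j; lia.
apply: allpairs_f; last exact: Ds.
apply: allpairs_f; first by rewrite mem_iota ltn_mod.
by case: (previous _ _ _).
Qed.

Lemma entropy_le_subst X (D : set bsq) (b C : R) (s : nat -> seq (seq bool)) :
  1 <= b -> 0 < C ->
  (forall x, X x -> exists2 c, D c & x = subst rev m a ap false c) ->
  (forall c k n, D c -> mkseq (shift k c) n \in s n) ->
  (forall n, (size (s n))%:R <= C * b ^+ n) ->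
  entropy R X <= ln b / m%:R.
Proof.
move=> b1 C0 XD Ds hs; have b0 : 0 < b by apply: lt_le_trans b1.
apply: (@entropy_le _ _ _ ((m * 2)%N%:R * (C * b ^+ 2))) => //.
  by rewrite !mulr_gt0 ?exprn_gt0 // ltr0n muln_gt0 m0.
move=> n; apply: (@le_trans _ _ (m * 2 * size (s (n %/ m + 2)%N))%N%:R).
  by rewrite ler_nat; apply: (word_count_subst XD) => c k Dc; apply: Ds.
rewrite natrM -[leRHS]mulrA ler_wpM2l //; apply: le_trans (hs _) _.
by rewrite exprD; rewrite [_ * b ^+ 2]mulrC !mulrA.
Qed.

Lemma entropy_le_kneading X (b : R) : 1 < b -> b <= 2 -> generic b 1 ->
  (forall x, X x -> exists2 c, univoque negb (kneading b) c & x = subst rev m a ap false c) ->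
  entropy R X <= ln b / m%:R.
Proof.
move=> b1 b2 g1 XD; have [C C0 hC] := branch_count_bound b1 b2 g1.
apply: (entropy_le_subst (ltW b1) C0 XD (s := fun n => branches b n (-1) 1)) => //.
move=> c k n uc; apply: mem_branches_univoque => //; exact: univoque_shift.
Qed.

Lemma entropy_le_full X :
  (forall x, X x -> exists c, x = subst rev m a ap false c) ->
  entropy R X <= ln 2 / m%:R.
Proof.
move=> XD.
apply: (@entropy_le_subst X setT 2 1 (fun n => [seq val t | t <- enum {: n.-tuple bool}])) => //.
- by rewrite ler1n.
- by move=> x /XD[c ->]; exists c.
- move=> c k n _; apply/mapP.
  by exists (Tuple (introT eqP (size_mkseq (shift k c) n))); rewrite ?mem_enum.
- by move=> n; rewrite size_map -cardE card_tuple card_bool mul1r natrX.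
Qed.

End Substitution.
End Entropy.

(** * Admissible words as blocks *)

Section Words.
Context {M : nat}.
Implicit Types (a u v w : word M).
Local Notation digit := 'I_M.+1.
Local Notation revd := (@rev_ord M.+1).

Lemma rev_ord_lt (x y : digit) : (rev_ord x < rev_ord y)%O = (y < x)%O.
Proof. by rewrite !ltEord /=; case: x => x hx; case: y => y hy /=; lia. Qed.

Lemma word_lt_diff u v : size u = size v -> (u < v)%O ->
  exists j, [/\ (j < size u)%N, (forall l, (l < j)%N -> nth ord0 u l = nth ord0 v l)
              & (nth ord0 u j < nth ord0 v j)%O].
Proof.
elim: u v => [|x u IH] [|y v] //=.
move=> [sz]; rewrite ltxi_cons => /andP[xy]; rewrite leNgt.
have [lt_xy|] := boolP (x < y)%O; first by move=> _; exists 0%N; split.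
rewrite -leNgt => yx /= lt_uv; have xE : x = y by apply/eqP; rewrite eq_le xy yx.
have [j [ju agr lt_j]] := IH v sz lt_uv.
by exists j.+1; split=> //; case=> //= l /agr.
Qed.

Lemma size_wplus w : (0 < size w)%N -> size (wplus w) = size w.
Proof.
by move=> w0; rewrite size_rcons size_takel ?leq_pred // prednK.
Qed.

Lemma nth_wplus w i : (0 < size w)%N -> (i < size w)%N ->
  nth ord0 (wplus w) i =
  if i == (size w).-1 then inord (nth ord0 w i).+1 else nth ord0 w i.
Proof.
move=> w0 iw; rewrite nth_rcons size_takel ?leq_pred //.
have [->|ne] := eqVneq i (size w).-1; first by rewrite ltnn nth_last.
by rewrite ifT ?nth_take //; lia.
Qed.

Lemma admissible_size a : admissible a -> (0 < size a)%N.
Proof. by case=> [[h _]|[_ [d -> _]]] //; apply: leq_trans h. Qed.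

Lemma admissible_last a : admissible a -> (nth ord0 a (size a).-1 < M)%N.
Proof.
case=> [[m2 h]|[_ [d -> /= /andP[_ //]]]].
have [|_] := h (size a).-1; first by lia.
have -> : (size a - (size a).-1 = 1)%N by lia.
move=> /word_lt_diff[|j [ltj _]].
  by rewrite size_drop size_takel //; lia.
move: ltj; rewrite size_drop (_ : size a - (size a).-1 = 1)%N; last by lia.
case: j => // _; rewrite nth_drop addn0 nth_take // ltEord /=.
by move/leq_trans; apply; rewrite -ltnS.
Qed.

Definition digits a : Omega M := nth ord0 a.

Lemma admissible_renormalizing a : admissible a ->
  renormalizing_block revd (size a) (digits a) (digits (wplus a)).
Proof.
move=> adm; have m0 := admissible_size adm; have lastM := admissible_last adm.
have lt_m : ((size a).-1 < size a)%N by rewrite prednK.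
have plus_last : (nth ord0 (wplus a) (size a).-1 : nat) = (nth ord0 a (size a).-1).+1.
  by rewrite nth_wplus // eqxx inordK.
have agr : agree (size a).-1 (digits (wplus a)) (digits a).
  by move=> i lti; rewrite /digits nth_wplus //; [rewrite ltn_eqF|lia].
split=> //.
- exact: rev_ordK.
- exact: rev_ord_lt.
- by rewrite /digits ltEord /= plus_last.
- by move=> c; rewrite /digits ltEord leEord /= plus_last.
- rewrite /digits; case: adm => [[m2 h]|[M2 [d aE /andP[h1 h2]]]].
    have [|h1 h2] := h (size a).-1; first by lia.
    rewrite nth_wplus // ifF; last by lia.
    have sz1 : (size a - (size a).-1 = 1)%N by lia.
    rewrite sz1 in h1 h2; have hd : take 1 a = [:: nth ord0 a 0].
      by rewrite (take_nth ord0) // take0.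
    have tl : drop (size a).-1 a = [:: nth ord0 a (size a).-1].
      by rewrite (drop_nth ord0) // prednK // drop_size.
    rewrite hd tl in h1 h2; rewrite lexi_cons lexx implybT andbT in h1.
    by move: h2; rewrite ltxi_cons ltxx implybF -ltNge => /andP[_ h2]; apply: le_lt_trans h2.
  rewrite aE /= in plus_last *; rewrite ltEord /= plus_last; move: h1 => /=.
  by rewrite ltnS.
- move=> i hi; case: adm => [[m2 h]|[M2 [d aE _]]]; last by rewrite aE /= in hi; lia.
  have [h1 _] := h i hi; move: h1; rewrite le_eqVlt => /predU1P[E|].
    left=> j ltj; have := congr1 (fun w => nth ord0 w j) E.
    rewrite (nth_map ord0) ?size_takel ?leq_subr // nth_drop nth_take //.
  move=> /word_lt_diff[|j [ltj agj lt_j]].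
    by rewrite size_map size_drop size_takel // leq_subr.
  rewrite size_map size_takel ?leq_subr // in ltj.
  right; exists j; split=> //.
    move=> l ltl; have := agj l ltl; have ltl' := ltn_trans ltl ltj.
    rewrite (nth_map ord0) ?size_takel ?leq_subr // nth_drop nth_take //.
  by move: lt_j; rewrite (nth_map ord0) ?size_takel ?leq_subr // nth_drop nth_take.
- move=> i hi; case: adm => [[m2 h]|[M2 [d aE _]]]; last by rewrite aE /= in hi; lia.
  have [_ /word_lt_diff[|j [ltj agj lt_j]]] := h i hi.
    by rewrite size_drop size_takel // leq_subr.
  rewrite size_drop in ltj; exists j; split=> //.
    move=> l ltl; have := agj l ltl; have ltl' := ltn_trans ltl ltj.
    by rewrite nth_drop nth_take.
  by move: lt_j; rewrite nth_drop nth_take.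
Qed.

Lemma nth_flatten_uniform (ws : seq (word M)) m e r : all (fun w => size w == m) ws ->
  (r < m)%N -> nth ord0 (flatten ws) (e * m + r) = nth ord0 (nth [::] ws e) r.
Proof.
move=> + rm; elim: ws e => [|w ws IH] e /=; first by rewrite !nth_nil.
move=> /andP[/eqP sw /IH {}IH]; rewrite nth_cat sw; case: e => [|e].
  by rewrite mul0n add0n rm.
rewrite ifF; last by lia.
by rewrite -IH; congr nth; lia.
Qed.

Lemma wcycle_flatten (ws : seq (word M)) m k r : all (fun w => size w == m) ws ->
  (0 < size ws)%N -> (r < m)%N ->
  wcycle (flatten ws) (k * m + r)%N = nth ord0 (nth [::] ws (k %% size ws)) r.
Proof.
move=> sz ws0 rm; rewrite /wcycle.
have -> : size (flatten ws) = (size ws * m)%N.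
  elim: ws sz {ws0} => //= w ws IH /andP[/eqP sw /IH {}IH].
  by rewrite size_cat sw IH mulSn.
rewrite {1}(divn_eq k (size ws)) mulnDl -addnA -mulnA modnMDl modn_small.
  exact: nth_flatten_uniform.
have := ltn_pmod k ws0; nia.
Qed.

Lemma double_golden_mod4 k : double golden k = (k %% 4 < 2)%N.
Proof.
have := divn_eq k 2; move: (k %/ 2)%N (k %% 2)%N (ltn_pmod k (isT : (0 < 2)%N)).
move=> l [|[|//]] _ ->.
  by rewrite addn0 double_even; case: l => [|l] //=; rewrite /golden negbK; lia.
by rewrite double_odd /golden; lia.
Qed.

Section Admissible.
Variable a : word M.
Hypothesis adm : admissible a.
Local Notation m := (size a).
Local Notation sub := (subst revd m (digits a) (digits (wplus a))).
Local Notation blk := (sub_block revd (digits a) (digits (wplus a))).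
Let A := admissible_renormalizing adm.
Let m0 : (0 < m)%N := admissible_size adm.

Lemma nth_block p c i : (i < m)%N -> blk p c i =
  nth ord0 (if c then (if p then refl_word a else wplus a)
            else (if p then refl_word (wplus a) else a)) i.
Proof.
move=> im; case: c; case: p => //=; rewrite /reflect_seq /refl_word (nth_map ord0) //.
by rewrite size_wplus.
Qed.

Lemma eq_blocks (x y : Omega M) :
  (forall k r, (r < m)%N -> x (k * m + r)%N = y (k * m + r)%N) -> x = y.
Proof. by move=> h; apply: funext => i; rewrite (divn_eq i m) h // ltn_mod. Qed.

Lemma wcycle_subst : wcycle a = sub false zeros.
Proof.
apply: eq_blocks => k r rm; rewrite (subst_at A) // nth_block //.
have := @wcycle_flatten [:: a] m k r; rewrite /= cats0 eqxx modn1 => -> //.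
by case: k.
Qed.

Lemma prepend_subst : prepend (wplus a) (wcycle (refl_word a)) = sub false ones.
Proof.
apply: eq_blocks => k r rm; rewrite (subst_at A) // nth_block // /prepend size_wplus //.
case: k => [|k] /=; first by rewrite mul0n add0n rm.
rewrite ifF; last by lia.
have -> : (k.+1 * m + r - m = k * m + r)%N by lia.
have := @wcycle_flatten [:: refl_word a] m k r.
by rewrite /= cats0 size_map eqxx modn1 => ->.
Qed.

Lemma wcycle_golden : wcycle (wplus a ++ refl_word (wplus a)) = sub false golden.
Proof.
apply: eq_blocks => k r rm; rewrite (subst_at A) // nth_block //.
have := @wcycle_flatten [:: wplus a; refl_word (wplus a)] m k r.
rewrite /= cats0 size_map size_wplus // eqxx => -> //.
rewrite modn2 /golden; case: k => [|k] //=; rewrite negbK.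
by case: (odd k).
Qed.

Lemma wcycle_double_golden :
  wcycle (wplus a ++ refl_word a ++ refl_word (wplus a) ++ a) = sub false (double golden).
Proof.
apply: eq_blocks => k r rm; rewrite (subst_at A) // nth_block //.
have := @wcycle_flatten [:: wplus a; refl_word a; refl_word (wplus a); a] m k r.
rewrite /= cats0 !size_map size_wplus // eqxx => -> //.
have -> : previous false (double golden) k = (0 < k %% 4 < 3)%N.
  by case: k => //= k; rewrite double_golden_mod4; lia.
rewrite double_golden_mod4; move: (k %% 4)%N (ltn_pmod k (isT : (0 < 4)%N)).
by case=> [|[|[|[|]]]].
Qed.

Lemma block_succ p : (blk p true m.-1 : nat) = (blk p false m.-1).+1.
Proof.
have lastM := admissible_last adm; have lt_m : (m.-1 < m)%N by rewrite prednK.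
have plus_last : (digits (wplus a) m.-1 : nat) = (digits a m.-1).+1.
  by rewrite /digits nth_wplus // eqxx inordK.
case: p => /=; last exact: plus_last.
rewrite /reflect_seq /= plus_last; have : (digits a m.-1 < M)%N := lastM.
move: (nat_of_ord (digits a m.-1)) => z; lia.
Qed.

Lemma size_theta_prefix k : size (theta_prefix a k) = (2 ^ k * m)%N.
Proof.
elim: k => [|k IH] /=; first by rewrite size_wplus // mul1n.
rewrite size_cat size_wplus; last by rewrite size_map IH muln_gt0 expn_gt0 m0.
by rewrite size_map IH addnn -mul2n mulnA expnS.
Qed.

(** The second half of a prefix of [theta] is the reflection of the first with
    its last digit increased; for the code this is the Thue-Morse doubling. *)
Lemma nth_theta_prefix k i : (i < 2 ^ k * m)%N ->
  nth ord0 (theta_prefix a k) i = sub false thue_morse i.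
Proof.
have lt_m : (m.-1 < m)%N by rewrite prednK.
elim: k i => [|k IH] i lti.
  rewrite expn0 mul1n in lti; rewrite -[i in RHS]add0n -(mul0n m) (subst_at A) //=.
have szk := size_theta_prefix k.
have p0 : (0 < 2 ^ k)%N by rewrite expn_gt0.
rewrite [theta_prefix a k.+1]/= nth_cat szk; case: ifP => [|/negbT]; first exact: IH.
rewrite -leqNgt => lei; pose j := ((i - 2 ^ k * m) %/ m)%N; pose r := ((i - 2 ^ k * m) %% m)%N.
have rm : (r < m)%N by rewrite ltn_mod.
have iE : (i - 2 ^ k * m = j * m + r)%N by apply: divn_eq.
have jk : (j < 2 ^ k)%N by rewrite ltn_divLR // ltn_subLR // addnn -mul2n mulnA -expnS.
have iE' : (i = (2 ^ k + j) * m + r)%N by rewrite -(subnKC lei) iE mulnDl addnA.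
rewrite iE {1}iE' (subst_at A) // nth_wplus ?size_map ?szk ?muln_gt0 ?p0 //; last by nia.
rewrite (nth_map ord0) ?szk; last by nia.
rewrite IH; last by nia.
rewrite (subst_at A) //.
have prev : previous false thue_morse (2 ^ k + j) = ~~ previous false thue_morse j.
  case: j jk {iE iE'} => [|j] jk; last by rewrite addnS /= thue_morse_half //; lia.
  have -> : (2 ^ k + 0 = (2 ^ k).-1.+1)%N by lia.
  by rewrite /= thue_morse_pow2.
have refl_blk : rev_ord (blk (previous false thue_morse j) (thue_morse j) r) =
    blk (previous false thue_morse (2 ^ k + j)) (~~ thue_morse j) r.
  by rewrite prev -(reflect_block A).
rewrite refl_blk.
have [lt_j|ge_j] := ltnP j (2 ^ k).-1.
  rewrite ifF; last by apply/negbTE/eqP; nia.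
  by rewrite thue_morse_half.
have jE : j = (2 ^ k).-1 by lia.
have -> : thue_morse (2 ^ k + j)%N = true.
  have -> : (2 ^ k + j = (2 ^ k.+1).-1)%N by rewrite jE expnS; lia.
  exact: thue_morse_pow2.
have -> : thue_morse j = true by rewrite jE; apply: thue_morse_pow2.
case: eqP => [E|nE].
  have -> : r = m.-1 by nia.
  by apply: val_inj; rewrite /= -block_succ inordK ?ltn_ord.
by apply: (block_agree A); nia.
Qed.

Lemma theta_subst : theta a = sub false thue_morse.
Proof.
apply: funext => i; apply: nth_theta_prefix.
have : (i < 2 ^ i)%N by apply: ltn_expl.
by move=> h; apply: leq_trans h _; rewrite leq_pmulr.
Qed.

Lemma UrelP (R : realType) (q : R) (x : Omega M) :
  Urel a q x <-> univoque revd (alpha M q) x /\ agree m x (digits (wplus a)).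
Proof.
split=> -[ux hx]; split=> //.
  by move=> i im; rewrite /digits -hx nth_mkseq.
apply: (@eq_from_nth _ ord0); first by rewrite size_mkseq size_wplus.
by move=> i; rewrite size_mkseq => im; rewrite nth_mkseq // hx.
Qed.

End Admissible.
End Words.

(** * Monotone functions with dense values, and small covers *)

Section SmallCovers.
Context {R : realType}.
Local Notation mu := (@lebesgue_measure R).

Lemma negligible_small_cover (B : set R) :
  (forall e : R, 0 < e -> exists U, [/\ measurable U, (mu U <= e%:E)%E & B `<=` U]) ->
  mu.-negligible B.
Proof.
move=> h; have ex n : exists U, [/\ measurable U, (mu U <= (n.+1%:R^-1)%:E)%E & B `<=` U].
  by apply: h; rewrite invr_gt0.
have [U hU] := choice ex.
have mI : measurable (\bigcap_n U n).
  by apply: bigcapT_measurable => n; have [] := hU n.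
exists (\bigcap_n U n); split=> //; last by move=> x Bx n _; have [_ _] := hU n; apply.
apply/eqP; rewrite eq_le measure_ge0 andbT; apply/lee_addgt0Pr => e e0.
rewrite add0e; pose n := Num.truncn e^-1.
have [mUn hn _] := hU n; apply: (@le_trans _ _ (mu (U n))).
  by apply: le_measure; rewrite ?inE //; apply: bigcap_inf.
apply: le_trans hn _; rewrite lee_fin -[leRHS]invrK lef_pV2 ?posrE ?invr_gt0 //.
exact/ltW/truncnS_gt.
Qed.

Fixpoint balls_union (delta : R) (s : seq R) : set R :=
  if s is x :: s' then `[x - delta, x + delta]%classic `|` balls_union delta s' else set0.

Lemma closed_balls_union delta s : closed (balls_union delta s).
Proof.
elim: s => [|x s IH] /=; first exact: closed0.
by apply: closedU => //; apply: interval_closed.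
Qed.

Lemma measurable_balls_union delta s : measurable (balls_union delta s).
Proof.
elim: s => [|x s IH] /=; first exact: measurable0.
by apply: measurableU => //; exact: measurable_itv.
Qed.

Lemma measure_balls_union (delta : R) s : 0 < delta ->
  (mu (balls_union delta s) <= ((size s)%:R * (2 * delta))%:E)%E.
Proof.
move=> d0; elim: s => [|x s IH] /=; first by rewrite measure0 mul0r.
set I := `[x - delta, x + delta]%classic.
have mI : measurable I by exact: measurable_itv.
apply: (@le_trans _ _ (mu I + mu (balls_union delta s))%E).
  by apply: measureU2 => //; exact: measurable_balls_union.
rewrite -natr1 mulrDl addrC mul1r EFinD; apply: leeD => //.
rewrite lebesgue_measure_itv /= lte_fin ifT; last by lra.
by rewrite EFinN -EFinB lee_fin; lra.
Qed.

Lemma in_balls_union (delta : R) s x y : y \in s -> `|x - y| <= delta -> balls_union delta s x.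
Proof.
move=> + h; elim: s => //= z s IH; rewrite inE => /orP[/eqP <-|/IH]; [left|by right].
rewrite /= in_itv /=; move: h; rewrite ler_norml => /andP[h1 h2].
by apply/andP; split; lra.
Qed.

End SmallCovers.

Section DenseValues.
Context {R : realType}.
Variables (f : R -> R) (l r top : R) (Q : R -> Prop).
Local Notation I := (`]l, r]%classic : set R).
Hypothesis f_mono : forall x y, l < x <= r -> l < y <= r -> x <= y -> f x <= f y.
Hypothesis f_range : forall x, l < x <= r -> 0 <= f x <= top.
Hypothesis f_values : forall u v, 0 <= u -> u < v -> v <= top ->
  exists q, [/\ l < q <= r, u < f q < v & Q q].

Let f_lt_inv x y : l < x <= r -> l < y <= r -> f x < f y -> x < y.
Proof.
move=> Ix Iy lt_f; rewrite ltNge; apply/negP => yx.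
by have := f_mono Iy Ix yx; rewrite leNgt lt_f.
Qed.

(** A jump of a monotone function would leave a gap among its values. *)
Lemma dense_values_continuous : {within I, continuous f}.
Proof.
apply/subspace_continuousP => x; rewrite /= in_itv /= => Ix.
have /andP[fx0 fxt] := f_range Ix.
apply/cvgrPdist_le => e e0.
have [u xu hu] : exists2 u, x < u & forall y, l < y <= r -> y < u -> f y <= f x + e.
  have [big|small] := leP top (f x + e).
    exists (x + 1); first by rewrite ltrDl.
    by move=> y Iy _; apply: le_trans big; have /andP[] := f_range Iy.
  have lt_e : f x < f x + e by rewrite ltrDl.
  have [q [Iq /andP[h1 h2] _]] := f_values fx0 lt_e (ltW small).
  exists q; first exact: f_lt_inv.
  by move=> y Iy /ltW yq; apply: le_trans (ltW h2); apply: f_mono.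
have [v vx hv] : exists2 v, v < x & forall y, l < y <= r -> v < y -> f x - e <= f y.
  have [neg|pos] := ltP (f x - e) 0.
    exists (x - 1); first by rewrite gtrBl.
    move=> y Iy _; apply: le_trans (ltW neg) _; by have /andP[] := f_range Iy.
  have lt_e : f x - e < f x by rewrite gtrBl.
  have [q [Iq /andP[h1 h2] _]] := f_values pos lt_e fxt.
  exists q; first exact: f_lt_inv.
  by move=> y Iy /ltW qy; apply: le_trans (ltW h1) _; apply: f_mono.
rewrite near_withinE.
have xvu : x \in `]v, u[ by rewrite in_itv /= vx xu.
apply: filterS (near_in_itvoo xvu) => y; rewrite in_itv /= => /andP[vy yu].
rewrite /= in_itv /= => Iy; rewrite ler_distlC.
by rewrite hu ?hv.
Qed.

(** Between two different values of [f] there is the value at a point of [Q], which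
    lies between the two arguments by monotonicity. *)
Lemma dense_values_locally_constant x delta : 0 < delta -> l < x <= r ->
  (forall y, l < y <= r -> `|y - x| < delta -> ~ Q y) ->
  \forall y \near within I (nbhs x), f y = f x.
Proof.
move=> d0 Ix no; rewrite near_withinE.
have /andP[fx0 fxt] := f_range Ix.
have xI : x \in `]x - delta, x + delta[ by rewrite in_itv /= gtrBl ltrDl d0.
apply: filterS (near_in_itvoo xI) => y; rewrite in_itv /= => /andP[y1 y2].
rewrite /= in_itv /= => Iy; have /andP[fy0 fyt] := f_range Iy.
case: (ltgtP (f y) (f x)) => // lt_f.
  have [q [Iq /andP[h1 h2] Qq]] := f_values fy0 lt_f fxt.
  have yq := f_lt_inv Iy Iq h1; have qx := f_lt_inv Iq Ix h2.
  case: (no q Iq _ Qq); rewrite ltr_distl (lt_trans y1 yq) /=.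
  by apply: lt_trans qx _; rewrite ltrDl.
have [q [Iq /andP[h1 h2] Qq]] := f_values fx0 lt_f fyt.
have xq := f_lt_inv Ix Iq h1; have qy := f_lt_inv Iq Iy h2.
case: (no q Iq _ Qq); rewrite ltr_distl (lt_trans qy y2) andbT.
by apply: lt_trans _ xq; rewrite gtrBl.
Qed.

End DenseValues.

(** * The entropy function on a basic interval *)

Section Plateau.
Context {R : realType} {M : nat}.
Variables (a : word M) (qL qR : R).
Hypothesis gen : generates a qL qR.
Local Notation revd := (@rev_ord M.+1).
Local Notation m := (size a).
Local Notation sub := (subst revd m (digits a) (digits (wplus a)) false).
Local Notation bsq := bitseq_order.
Local Notation refb := (reflect_seq negb).
Local Notation H := (Hrel a : R -> R).

Let adm : admissible a. Proof. by case: gen. Qed.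
Let A := admissible_renormalizing adm.
Let m0 : (0 < m)%N := admissible_size adm.
Let mR : 0 < m%:R :> R. Proof. by rewrite ltr0n. Qed.

Let sub_lt (c c' : bsq) : (sub c < sub c')%O = (c < c')%O. Proof. exact: lt_subst. Qed.
Let sub_le (c c' : bsq) : (sub c <= sub c')%O = (c <= c')%O. Proof. exact: le_subst. Qed.

Lemma le_ones (c : bsq) : (c <= ones)%O.
Proof. by rewrite leNgt; apply/negP => /seq_ltP[k [_]]; case: (c k). Qed.

Lemma zeros_le (c : bsq) : (zeros <= c)%O.
Proof. by rewrite leNgt; apply/negP => /seq_ltP[k [_]]; case: (c k). Qed.

Lemma plateau_ends : [/\ 1 < qL, qL < qR, qR <= M.+1%:R,
  alpha M qL = sub zeros & alpha M qR = sub ones].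
Proof.
have [_ [/andP[qL1 qLM] aL] [/andP[qR1 qRM] aR]] := gen.
rewrite wcycle_subst // in aL; rewrite prepend_subst // in aR; split=> //.
apply: (alpha_lt_inv (M := M)) => //; rewrite aL aR sub_lt.
by apply/seq_ltP; exists 0%N.
Qed.

Let qL1 : 1 < qL. Proof. by case: plateau_ends. Qed.
Let qRM : qR <= M.+1%:R. Proof. by case: plateau_ends. Qed.
Let alpha_qR : alpha M qR = sub ones. Proof. by case: plateau_ends. Qed.

(** One half of the reduction to binary sequences: an upper bound on [alpha(q)] in
    the image of the substitution turns into a threshold for the codes. *)
Lemma Urel_coded (t : bsq) (q : R) x : t 0%N -> (alpha M q <= sub t)%O -> Urel a q x ->
  exists c : bsq, [/\ c 0%N, univoque negb t c & x = sub c].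
Proof.
move=> t0 qt /(UrelP adm)[ux x_ap].
have q_ones : (alpha M q <= sub ones)%O by apply: le_trans qt _; rewrite sub_le le_ones.
have [c [c0 xE]] := univoque_decomposition A q_ones ux x_ap.
exists c; split=> //; apply: (univoque_subst_inv A c0 qt t0).
by rewrite -xE.
Qed.

(** The other half, for a lower bound on [alpha(q)]. *)
Lemma Urel_sub (t c : bsq) (q : R) : t 0%N -> (sub t <= alpha M q)%O -> c 0%N ->
  univoque negb t c -> Urel a q (sub c).
Proof.
move=> t0 tq c0 uc; apply/(UrelP adm); split; last exact: (subst_prefix A).
apply: (univoque_mono (rb_revK A) (rb_rev_lt A) tq).
exact: (univoque_subst_bits A).
Qed.

(** If the lower bound is strict, the codes may reach the threshold. *)
Lemma Urel_sub_strict (t c : bsq) (q : R) : t 0%N -> (sub t < alpha M q)%O ->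
  (alpha M q <= sub ones)%O -> c 0%N ->
  (forall n, (shift n c <= t)%O /\ (shift n (refb c) <= t)%O) -> Urel a q (sub c).
Proof.
move=> t0 tq q_ones c0 hc; apply/(UrelP adm); split; last exact: (subst_prefix A).
have t_ap := subst_prefix A t0; have o_ap : agree m (sub ones) (digits (wplus a)).
  exact: (subst_prefix A).
have [q_t _] := agree_squeeze (agree_trans t_ap (agree_sym o_ap)) (ltW tq) q_ones.
apply: (univoque_subst A); first exact: agree_trans q_t t_ap.
by move=> n; have [h1 h2] := hc n; split; apply: le_lt_trans tq; rewrite sub_le.
Qed.

Lemma Hrel_ge0 q : 0 <= H q.
Proof. exact: entropy_ge0. Qed.

Lemma Hrel_mono p q : 1 < p -> p <= q -> q <= M.+1%:R -> H p <= H q.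
Proof.
move=> p1 pq qM; apply: entropy_mono => x /(UrelP adm)[ux x_ap].
apply/(UrelP adm); split=> //.
by apply: (univoque_mono (rb_revK A) (rb_rev_lt A) _ ux); apply: alpha_le.
Qed.

Lemma Hrel_le_ln2 q : 1 < q -> q <= qR -> H q <= ln 2 / m%:R.
Proof.
move=> q1 qq; apply: (entropy_le_full A) => x /(Urel_coded (t := ones))[//||c [_ _ ->]].
  by rewrite -alpha_qR alpha_le.
by exists c.
Qed.

Lemma Hrel_le_kneading (b q : R) : 1 < b -> b <= 2 -> generic b 1 ->
  (alpha M q <= sub (kneading b))%O -> H q <= ln b / m%:R.
Proof.
move=> b1 b2 g1 qb; apply: (entropy_le_kneading A b1 b2 g1) => x.
by move=> /(Urel_coded (kneading0 b) qb)[c [_ uc ->]]; exists c.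
Qed.

(** Each application of [double] doubles the length of a sequence and so halves the
    growth rate. *)
Lemma Hrel_ge_iter (b : R) k (q : R) : 1 < b -> b <= 2 ->
  (sub (iter k double (kneading b)) <= alpha M q)%O ->
  ln b / (2 ^ k * m)%N%:R <= H q.
Proof.
move=> b1 b2 bq.
apply: (@entropy_ge_kneading _ _ _ _ _ (fun c => sub (iter k double c))) => //.
- by rewrite muln_gt0 expn_gt0.
- move=> c uc c0; have kb0 j : iter j double (kneading b) 0%N.
    by apply: iter_double0; apply: kneading0.
  apply: (Urel_sub (kb0 k) bq); first exact: iter_double0.
  elim: k {bq} => //= k IH; exact: (univoque_subst_bits block10).
- move=> n c c' agr; rewrite mulnC divnMA.
  have {}agr : agree (n %/ m) (iter k double c) (iter k double c').
    by apply: (agree_subst_inv A (p := false)); apply: agree_le agr; apply: leq_divM.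
  elim: k (n %/ m)%N agr {bq} => [|k IH] l agr; first by rewrite divn1.
  rewrite expnS divnMA; apply: IH.
  apply: (agree_subst_inv block10 (p := false)); apply: agree_le agr.
  exact: leq_divM.
Qed.

(** The last digit of the larger block is positive, so the code itself would end with
    zeros, and a shift of its reflection would be [1^oo]. *)
Lemma sub_not_zeros (t : bsq) : (forall n, (shift n (refb t) <= t)%O) -> t != ones ->
  ~ ends_with_zeros (sub t).
Proof.
move=> ht t1 [N hN].
have tN k : (N <= k)%N -> t k = false.
  move=> Nk; apply/negbTE/negP => tk.
  have : sub t (k * m + m.-1)%N = ord0 by apply: hN; nia.
  rewrite (subst_at A) ?prednK // tk => E.
  by have := block_succ adm (previous false t k); rewrite E.
have shN : shift N (refb t) = ones.
  by apply: funext => i; rewrite /shift /reflect_seq tN // leq_addr.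
by have := ht N; rewrite shN => le1; move: t1; rewrite eq_le le_ones le1.
Qed.

(** The kneading sequence of a generic [b] is a threshold with growth rate exactly
    [b], it is the code of some [alpha(q)], and the generic [b] are dense in
    ]1, 2[. *)
Lemma Hrel_values (u v : R) : 0 <= u -> u < v -> v <= ln 2 / m%:R ->
  exists q (c : bsq), [/\ qL < q <= qR, u < H q < v & alpha M q = sub c].
Proof.
move=> u0 uv v2.
have uv' : expR (m%:R * u) < expR (m%:R * v) by rewrite ltr_expR ltr_pM2l.
have [b [ub bv g1]] := generic_one_dense uv'.
have b1 : 1 < b by apply: le_lt_trans ub; rewrite -[leLHS]expR0 ler_expR mulr_ge0 // ltW.
have b0 : 0 < b by apply: lt_trans b1.
have b_lt2 : b < 2.
  apply: (lt_le_trans bv); rewrite -[leRHS](@lnK R) ?posrE // ler_expR.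
  by rewrite mulrC -ler_pdivlMr.
have b2 := ltW b_lt2.
have lnb : u < ln b / m%:R < v.
  rewrite ltr_pdivlMr // ltr_pdivrMr // ![_ * m%:R]mulrC.
  by rewrite -ltr_expR lnK ?posrE // ub -ltr_expR lnK ?posrE.
have k1 := kneading0 b.
have kz : kneading b != zeros by apply/eqP => E; rewrite E in k1.
have ko := kneading_neq_ones b1 b_lt2.
have [_ qLR _ aL _] := plateau_ends.
have aL_le : (alpha M qL <= sub (kneading b))%O by rewrite aL sub_le zeros_le.
have aR_ge : (sub (kneading b) <= alpha M qR)%O by rewrite alpha_qR sub_le le_ones.
have self_le n : (shift n (sub (kneading b)) <= sub (kneading b))%O.
  by apply: (subst_le_self A) => // i; have [] := shift_kneading_le b1 b2 i g1.
have nz : ~ ends_with_zeros (sub (kneading b)).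
  by apply: sub_not_zeros => // i; have [] := shift_kneading_le b1 b2 i g1.
have [q /andP[qLq qqR] aq] := alpha_surjective qL1 (ltW qLR) qRM aL_le aR_ge self_le nz.
exists q, (kneading b); split=> //.
  rewrite qqR andbT lt_neqAle qLq andbT; apply/eqP => E.
  move: aq; rewrite -E aL => /(subst_inj A) E'.
  by rewrite -E' eqxx in kz.
have := @Hrel_le_kneading b q b1 b2 g1; rewrite aq => /(_ (lexx _)) h1.
have := @Hrel_ge_iter b 0 q b1 b2; rewrite /= aq mul1n => /(_ (lexx _)) h2.
have -> : H q = ln b / m%:R by apply/eqP; rewrite eq_le h1 h2.
exact: lnb.
Qed.

Local Notation I := (`]qL, qR]%classic : set R).

Let Hrel_mono_I x y : qL < x <= qR -> qL < y <= qR -> x <= y -> H x <= H y.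
Proof.
move=> /andP[x1 x2] /andP[y1 y2] xy.
exact: Hrel_mono (lt_trans qL1 x1) xy (le_trans y2 qRM).
Qed.

Let Hrel_range x : qL < x <= qR -> 0 <= H x <= ln 2 / m%:R.
Proof.
move=> /andP[x1 x2]; rewrite Hrel_ge0 /=.
exact: Hrel_le_ln2 (lt_trans qL1 x1) x2.
Qed.

Let coded_base (q : R) := exists c, alpha M q = sub c.

Let Hrel_dense (u v : R) : 0 <= u -> u < v -> v <= ln 2 / m%:R ->
  exists q, [/\ qL < q <= qR, u < H q < v & coded_base q].
Proof.
move=> u0 uv v2; have [q [c [h1 h2 h3]]] := Hrel_values u0 uv v2.
by exists q; split=> //; exists c.
Qed.

(** Here [alpha(qL)] has period [m] and starts with a positive digit. *)
Lemma qL_pow_ge2 : 2 <= qL ^+ m.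
Proof.
have [_ qLR _ aL _] := plateau_ends.
have gL : greedy_remainders qL (alpha M qL).
  by apply: alpha_greedy => //; apply: le_trans qRM; apply: ltW.
apply: (periodic_pow_ge2 qL1 gL) => //.
  by rewrite aL -{1}[m]mul1n (shift_subst A).
rewrite aL -[0%N]add0n -(mul0n m) (subst_at A) //= lt0n; apply/eqP => a0.
have := rb_head A; rewrite ltEord /= a0 subn1 /= ltnNge => /negP; apply.
by rewrite -ltnS.
Qed.

Lemma alpha_gap q0 p q n : qL < q0 -> q0 <= p -> p <= q -> q <= qR ->
  agree n.+1 (alpha M p) (alpha M q) -> q - p <= (q0 ^+ n)^-1.
Proof.
move=> Lq0 q0p pq qq agr.
have q01 : 1 < q0 by apply: lt_trans Lq0.
have p1 : 1 < p by apply: lt_le_trans q0p.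
have qM : q <= M.+1%:R by apply: le_trans qRM.
have gp : greedy_remainders p (alpha M p) by apply: alpha_greedy => //; apply: le_trans qM.
have gq : greedy_remainders q (alpha M q) by apply: alpha_greedy => //; apply: lt_le_trans p1 pq.
have p0 : 0 < p by apply: lt_trans p1.
have := remainder_base_gap p0 pq gp agr.
have /andP[h1 _] := gp n.+1; have /andP[_ h2] := gq n.+1 => h.
have q00 : 0 < q0 by apply: lt_trans q01.
have qn : 0 < q0 ^+ n by rewrite exprn_gt0.
rewrite -[leRHS]mul1r ler_pdivlMr // mulrC.
apply: (@le_trans _ _ (p ^+ n * (q - p))); last by lra.
by rewrite ler_wpM2r ?subr_ge0 // lerXn2r // nnegrE ltW.
Qed.

(** The codes of length [K] cut the bases whose expansion is coded into [2 ^ K]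
    classes of diameter at most [q0 ^- (K m - 1)], and [q0 ^ m > 2]. *)
Lemma coded_bases_cover q0 e : qL < q0 -> 0 < e -> exists U : set R,
  [/\ closed U, measurable U, (lebesgue_measure U <= e%:E)%E &
      forall q c, q0 <= q <= qR -> alpha M q = sub c -> U q].
Proof.
move=> Lq0 e0.
have q01 : 1 < q0 by apply: lt_trans Lq0.
have q00 : 0 < q0 by apply: lt_trans q01.
pose r := q0 ^+ m / 2.
have r1 : 1 < r.
  rewrite ltr_pdivlMr // mul1r; apply: le_lt_trans qL_pow_ge2 _.
  by rewrite ltrXn2r ?gtn_eqF ?ltW // ?nnegrE // (lt_trans _ qL1).
have [k hk] := pow_unbounded (2 * q0 / e) r1.
pose K := k.+1; pose n := (K * m).-1.
have Km : n.+1 = (K * m)%N by rewrite prednK // muln_gt0.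
pose P (w : K.-tuple bool) q :=
  q0 <= q <= qR /\ exists2 c, alpha M q = sub c & forall i : 'I_K, c i = tnth w i.
(* a centre for each class; the value [0] is a default for empty classes *)
have ex w : exists q, forall q', P w q' -> P w q.
  have [[q Pq]|no] := pselect (exists q, P w q); first by exists q.
  by exists 0 => q' Pq'; case: no; exists q'.
have [f hf] := choice ex.
pose delta := (q0 ^+ n)^-1.
have d0 : 0 < delta by rewrite invr_gt0 exprn_gt0.
pose s := [seq f w | w <- enum {: K.-tuple bool}].
have sz : size s = (2 ^ K)%N by rewrite size_map -cardE card_tuple card_bool.
exists (balls_union delta s); split.
- exact: closed_balls_union.
- exact: measurable_balls_union.
- apply: le_trans (measure_balls_union s d0) _; rewrite lee_fin sz natrX.
  have -> : 2 ^+ K * (2 * delta) = 2 * q0 / r ^+ K.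
    have -> : r ^+ K = q0 * q0 ^+ n / 2 ^+ K.
      by rewrite exprMn exprVn -exprM mulnC -Km exprS.
    rewrite /delta; field; rewrite !expf_neq0 ?gt_eqF //.
  have rK : 0 < r ^+ K by rewrite exprn_gt0 // (lt_trans _ r1).
  rewrite ler_pdivrMr // [leRHS]mulrC -ler_pdivrMr //.
  apply: (le_trans (ltW hk)).
  by rewrite ler_eXn2l.
- move=> q c qq aq; pose w := [tuple c i | i < K].
  have Pq : P w q by split=> //; exists c => // i; rewrite tnth_mktuple.
  have [/andP[f1 f2] [c' ac' hc']] := hf w q Pq; have /andP[q1 q2] := qq.
  have agr : agree n.+1 (alpha M q) (alpha M (f w)).
    rewrite aq ac' Km; apply: (agree_subst A) => i iK.
    by have := hc' (Ordinal iK); rewrite tnth_mktuple.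
  apply: (@in_balls_union _ _ _ _ (f w)); first by apply: map_f; rewrite mem_enum.
  have [qf|fq] := leP q (f w).
    by rewrite ler0_norm ?subr_le0 // opprB (alpha_gap Lq0).
  rewrite ger0_norm ?subr_ge0 ?(ltW fq) // (alpha_gap Lq0 f1 (ltW fq)) //.
  exact: agree_sym.
Qed.

Lemma Hrel_ae_constant : {ae lebesgue_measure, forall x : R, I x ->
  \forall y \near within I (nbhs x), H y = H x}.
Proof.
pose F (j : nat) : set R := [set x | [/\ qL + j.+1%:R^-1 < x, x <= qR &
  ~ \forall y \near within I (nbhs x), H y = H x]].
have cover : ~` [set x : R | I x -> \forall y \near within I (nbhs x), H y = H x]
    `<=` \bigcup_j F j.
  move=> x /= /not_implyP[]; rewrite in_itv /= => /andP[qLx xq] nc.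
  exists (Num.truncn (x - qL)^-1) => //; split=> //.
  rewrite -ltrBrDl -[ltRHS]invrK ltf_pV2 ?posrE ?invr_gt0 ?subr_gt0 //.
  exact: truncnS_gt.
suff negl : (@lebesgue_measure R).-negligible (\bigcup_j F j) by
  have [N [mN N0 FN]] := negl; exists N; split=> //; exact: subset_trans cover FN.
apply: negligible_bigcup => j; apply: negligible_small_cover => e e0.
have Lq0 : qL < qL + j.+1%:R^-1 by rewrite ltrDl invr_gt0.
have [U [cU mU hU cov]] := coded_bases_cover Lq0 e0.
exists U; split=> // x [x1 x2 nc]; apply: contrapT => nU; apply: nc.
have /nbhs_ballP[d /= d0 hd] : nbhs x (~` U).
  by apply: open_nbhs_nbhs; split=> //; exact: closed_openC.
apply: (dense_values_locally_constant Hrel_mono_I Hrel_range Hrel_dense (delta := Num.min d (x - (qL + j.+1%:R^-1)))).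
- by rewrite lt_min d0 subr_gt0.
- by rewrite x2 andbT; apply: lt_trans x1.
- move=> y /andP[_ yq]; rewrite lt_min => /andP[yd yx] [c ay].
  apply: (hd y); first by rewrite /ball /= distrC.
  apply: cov ay; rewrite yq andbT; move: yx; rewrite ltr_norml => /andP[+ _].
  by rewrite opprB ltrD2r => /ltW.
Qed.

Lemma Hrel_devils_staircase : devils_staircase I H.
Proof.
split; last exact: Hrel_ae_constant.
  exact: dense_values_continuous Hrel_mono_I Hrel_range Hrel_dense.
by move=> x y /set_mem; rewrite /= in_itv /= => Ix /set_mem; rewrite /= in_itv /= => Iy; apply: Hrel_mono_I.
Qed.

(** * The relative univoque sets *)

Lemma Urel_golden_empty (q : R) : (alpha M q <= sub golden)%O -> Urel a q = set0.
Proof.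
move=> qg; apply/seteqP; split=> // x /(Urel_coded (t := golden) isT qg)[c [_ + _]].
exact: univoque_golden.
Qed.

Lemma Urel_golden_singleton (q : R) : (sub golden < alpha M q)%O ->
  (alpha M q <= sub (double golden))%O -> Urel a q = [set sub golden].
Proof.
move=> gq qg; apply/seteqP; split=> x.
  move=> /(Urel_coded (double0 golden) qg)[c [c0 uc ->]].
  by rewrite (univoque_double_golden c0 uc).
move=> ->; apply: (Urel_sub_strict _ gq) => //.
  by apply: le_trans qg _; rewrite sub_le le_ones.
by move=> n; apply: shift_golden_le.
Qed.

(** The sequences [(10)^k (1100)^oo] do not exceed the threshold [(1100)^oo]. *)
Lemma Urel_infinite (q : R) : (sub (double golden) < alpha M q)%O ->
  (alpha M q <= sub ones)%O -> infinite_set (Urel a q).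
Proof.
move=> gq qo; pose f k := sub (prefix10 k (double golden)).
have fi : injective f by move=> k l /(subst_inj A) /prefix10_double_golden_inj.
have in_U k : Urel a q (f k).
  apply: (Urel_sub_strict _ gq) => //; first exact: prefix10_0.
  by move=> n; apply: shift_prefix10_double_golden_le.
move=> finU; apply: infinite_nat.
have -> : [set: nat] = f @^-1` Urel a q by apply/seteqP; split=> k _ //=.
by apply: finite_preimage finU => k l _ _ /fi.
Qed.

(** The thresholds [double ^ k (10)^oo] increase to the Thue-Morse sequence, and each
    of them has only countably many univoque codes. *)
Lemma Urel_countable (q : R) : (alpha M q < sub thue_morse)%O -> countable (Urel a q).
Proof.
move=> qt.
have [|k hk] := lt_seq_near (z := fun k => sub (iter k double golden)) _ qt.
  move=> k; have pow_k : (k < 2 ^ k)%N by apply: ltn_expl.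
  apply: (agree_le (m := (2 ^ k * m)%N)).
    by rewrite (leq_trans (ltnW pow_k)) // leq_pmulr.
  exact/(agree_subst A)/agree_thue_morse.
have k0 : iter k double golden 0%N by apply: iter_double0.
apply: (@sub_countable _ _ _ (sub @` univoque negb (iter k double golden))).
  apply: subset_card_le => x /(Urel_coded k0 (ltW hk))[c [_ uc ->]].
  by exists c.
exact: sub_countable (card_image_le _ _) (countable_univoque_double k).
Qed.

(** The entropy vanishes because the Thue-Morse sequence is below the kneading
    sequences of all [b > 1], whose growth rate [b] is arbitrarily close to [1]. *)
Lemma Urel_thue_morse (q : R) : alpha M q = sub thue_morse ->
  ~ countable (Urel a q) /\ H q = 0.
Proof.
move=> aq; split.
  move=> cU; apply: uncountable_univoque_thue_morse.
  apply: (@countable_inj _ _ sub _ _ _ _ cU); first by move=> c c' _ _ /(subst_inj A).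
  by move=> c [uc c0]; apply: (Urel_sub thue_morse0) => //; rewrite aq.
apply/eqP; rewrite eq_le Hrel_ge0 andbT; apply/ler_addgt0Pr => e e0; rewrite add0r.
have min1 : 1 < Num.min 2 (1 + e) by rewrite lt_min ltr1n ltrDl.
have [b [b1 b2 g1]] := generic_one_dense min1.
move: b2; rewrite lt_min => /andP[/ltW b2 be].
apply: (@le_trans _ _ (ln b / m%:R)).
  apply: Hrel_le_kneading => //; rewrite aq sub_le.
  exact: thue_morse_le_kneading.
have lb : 0 <= ln b by apply/ln_ge0/ltW.
apply: (@le_trans _ _ (ln b)).
  by rewrite ler_piMr // invf_le1 // ler1n.
have lnE : ln b = ln (1 + (b - 1)) by rewrite addrC subrK.
by rewrite lnE (le_trans (le_ln1Dx _)) {aq} //; lra.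
Qed.

(** The thresholds [double ^ k 1^oo] decrease to the Thue-Morse sequence, and each of
    them has univoque codes of positive growth rate. *)
Lemma Hrel_pos (q : R) : (sub thue_morse < alpha M q)%O -> 0 < H q.
Proof.
move=> tq.
have [|k hk] := gt_seq_near (z := fun k => sub (iter k double ones)) _ tq.
  move=> k; have pow_k : (k < 2 ^ k)%N by apply: ltn_expl.
  apply: (agree_le (m := (2 ^ k * m)%N)).
    by rewrite (leq_trans (ltnW pow_k)) // leq_pmulr.
  exact/(agree_subst A)/agree_thue_morse.
have b1 : 1 < 2 :> R by rewrite ltr1n.
have bq : (sub (iter k double (kneading (2 : R))) <= alpha M q)%O.
  apply: le_trans (ltW hk); rewrite sub_le.
  by elim: k {hk} => [|k IH] /=; [apply: le_ones|rewrite le_double].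
apply: lt_le_trans (Hrel_ge_iter b1 (lexx _) bq).
by rewrite divr_gt0 ?ln_gt0 // ltr0n muln_gt0 expn_gt0.
Qed.

End Plateau.

Theorem theorem2 (R : realType) (M : nat) (hM : (1 <= M)%N)
    (a : word M) (qL qR qG qF qc : R)
    (hJ : relative_plateau M qL qR) (ha : generates a qL qR)
    (hG : has_alpha qG (wcycle (wplus a ++ refl_word (wplus a))))
    (hF : has_alpha qF
            (wcycle (wplus a ++ refl_word a ++ refl_word (wplus a) ++ a)))
    (hc : has_alpha qc (theta a)) :
  devils_staircase `]qL, qR] (Hrel a) /\
  [/\ (forall q : R, qL < q -> q <= qG -> Urel a q = set0),
      (forall q : R, qG < q -> q <= qF ->
         Urel a q = [set wcycle (wplus a ++ refl_word (wplus a))]),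
      (forall q : R, qF < q -> q < qc ->
         countable (Urel a q) /\ infinite_set (Urel a q)),
      (~ countable (Urel a qc) /\ Hrel a qc = 0) &
      (forall q : R, qc < q -> q <= qR -> 0 < Hrel a q)].
Proof.
have [adm _ _] := ha.
have [_ _ qRM _ alpha_qR] := plateau_ends ha.
case: hG => [/andP[qG1 qGM] aG]; case: hF => [/andP[qF1 qFM] aF].
case: hc => [/andP[qc1 qcM] ac].
rewrite wcycle_golden // in aG *; rewrite wcycle_double_golden // in aF.
rewrite theta_subst // in ac.
have qL1 : 1 < qL by case: (plateau_ends ha).
split; first exact: Hrel_devils_staircase.
split.
- move=> q Lq qqG; apply: (Urel_golden_empty ha).
  by rewrite -aG; apply: alpha_le => //; apply: lt_trans Lq.
- move=> q qGq qqF; apply: (Urel_golden_singleton ha).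
    by rewrite -aG; apply: alpha_lt => //; apply: le_trans qFM.
  by rewrite -aF; apply: alpha_le => //; apply: lt_trans qGq.
- move=> q qFq qqc; have q1 : 1 < q by apply: lt_trans qFq.
  have lt_c : (alpha M q < alpha M qc)%O by apply: alpha_lt.
  split; first by apply: (Urel_countable ha); rewrite -ac.
  apply: (Urel_infinite ha).
    by rewrite -aF; apply: alpha_lt => //; apply: le_trans qcM; apply: ltW.
  rewrite (le_trans (ltW lt_c)) // ac (le_subst (admissible_renormalizing adm)).
  exact: le_ones.
- have [unc H0] := Urel_thue_morse ha ac; split; [exact: unc|exact: H0].
- move=> q qcq qqR; apply: (Hrel_pos ha).
  by rewrite -ac; apply: alpha_lt => //; apply: le_trans qRM.
Qed.
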